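(* Let $\Lambda = L\big(t;\mathsf x^i,\mathsf v^i,\mathsf v'^i,\dots,\mathsf v^i_{(k-1)}\big)\,dt$ be a Lagrangian on $J^k(\mathbb R,Q)$, with $L$ smooth, and let $\mathsf E_i$ $(i=1,\dots,\dim Q)$, functions on $J^s(\mathbb R,Q)$ with $s\le 2k$, be its variational (Euler--Poisson) expressions, so that the variational equation of $\Lambda$ is $\mathsf E_i=0$. Consider the Lagrange function $$\mathcal L_0=(L\circ\wp^k)\,\dot t$$ defined on the set $\{\dot t\neq 0\}\subset T^kM$, where $M=\mathbb R\times Q$ has coordinates $x^0=t$, $x^i=\mathsf x^i$. Then the quantities $$\mathcal E_0=-u^i\,(\mathsf E_i\circ\wp^s),\qquad \mathcal E_i=\dot t\,(\mathsf E_i\circ\wp^s)$$ (summation over $i$ in the first formula), defined on $\{\dot t\ne0\}\subset T^sM$, are the variational (Euler--Poisson) expressions of the Lagrange function $\mathcal L_0$ with respect to the variables $x^0=t$ and $x^i$, the independent variable being the parameter $\zeta$.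
   Context: $Q$ is a manifold with local coordinates $\mathsf x^i$, and $M=\mathbb R\times Q$ with coordinates $x^\alpha=(t,x^i)$. $J^r(\mathbb R,Q)$ is the manifold of $r$-jets of curves $t\mapsto \mathsf x^i(t)$, with coordinates $(t;\mathsf x^i,\mathsf v^i,\mathsf v'^i,\mathsf v''^i,\dots,\mathsf v^i_{(r-1)})$, where $\mathsf v^i_{(q)}$ stands for $d^{q+1}\mathsf x^i/dt^{q+1}$. $T^rM$ is the manifold of $r$-th order Ehresmann velocities (derivatives at $0$, up to order $r$, of parametrized curves $\zeta\mapsto x^\alpha(\zeta)$), with coordinates $(x^\alpha,\dot x^\alpha,\ddot x^\alpha,\dots,x^\alpha_{(r)})$; the dot denotes $d/d\zeta$, and $u^\alpha=\dot x^\alpha$, so $u^0=\dot t$, $u^i=\dot x^i$. $\wp^r:\{\dot t\neq0\}\subset T^rM\to J^r(\mathbb R,Q)$ is the projection that sends the velocity of a parametrized curve $\zeta\mapsto(t(\zeta),x^i(\zeta))$ to the $r$-jet of the same curve regarded as the graph of a function $t\mapsto \mathsf x^i(t)$. Up to third order it is given implicitly by $$\dot t\,\mathsf v^i=u^i,\qquad \dot t^{\,3}\mathsf v'^i=\dot t\,\dot u^i-\ddot t\,u^i,\qquad \dot t^{\,5}\mathsf v''^i=\dot t^{\,2}\ddot u^i-3\,\dot t\,\ddot t\,\dot u^i+\big[3\,\ddot t^{\,2}-\dot t\,\dddot t\,\big]u^i .$$ The variational (Euler--Poisson) expressions of a Lagrange function of order $k$ are: for $L$, $\mathsf E_i=\frac{\partial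 L}{\partial \mathsf x^i}+\sum_{m=1}^k(-1)^m\big(\tfrac{d}{dt}\big)^m\frac{\partial L}{\partial \mathsf v^i_{(m-1)}}$; for $\mathcal L_0$, $\mathcal E_\alpha=\frac{\partial \mathcal L_0}{\partial x^\alpha}+\sum_{m=1}^k(-1)^m\big(\tfrac{d}{d\zeta}\big)^m\frac{\partial \mathcal L_0}{\partial x^\alpha_{(m)}}$, where $d/dt$ and $d/d\zeta$ are total derivatives. *)

(* Defs.v *)
From mathcomp Require Export all_boot all_order all_algebra.
From mathcomp Require Export all_classical all_reals all_analysis.
Set Implicit Arguments.
Unset Strict Implicit.
Unset Printing Implicit Defensive.
Import Order.TTheory GRing.Theory Num.Theory.
Import numFieldNormedType.Exports.
Local Open Scope ring_scope.
Local Open Scope classical_set_scope.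

(* Everything is expressed in a chart of Q, i.e. an open set U of R^n with
   n = dim Q, and in the induced chart R x U of M. *)

Section Smooth.
Context {R : realType} {V : normedModType R}.

Fixpoint Cn_on (p : nat) (D : set V) (f : V -> R) : Prop :=
  match p with
  | 0%N => forall x, D x -> {for x, continuous f}
  | p'.+1 => forall v, (forall x, D x -> derivable f x v) /\
                       Cn_on p' D ('D_v f)
  end.

(* Meant for open D: the values of f outside D are then irrelevant. *)
Definition smooth_on (D : set V) (f : V -> R) : Prop := forall p, Cn_on p D f.

End Smooth.

Definition smooth_near {R : realType} {m : nat} (c : R -> 'rV[R]_m) (z0 : R) :
    Prop :=
  \forall z \near z0, forall (p : nat) (i : 'I_m),
    derivable ((fun s => c s ord0 i)^`(p)) z 1.

(* A point of J^r(R, R^n) is (t, A), where row 0 of A is x and row q.+1 of A is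
   v_(q) = d^(q+1) x / dt^(q+1). *)
Definition jets (R : realType) (r n : nat) : normedModType R :=
  (R^o * 'M[R]_(r.+1, n))%type.

(* A point of T^r(R x R^n) is a matrix whose row q holds the q-th derivatives;
   column 0 is the coordinate t = x^0, column [lift ord0 i] is x^i. *)
Definition velocities (R : realType) (r n : nat) : normedModType R :=
  'M[R]_(r.+1, n.+1).

Section JetsAndVelocities.
Context {R : realType} {n : nat}.

(* The canonical projections onto lower order; only meant for r' <= r. *)
Definition jet_trunc {r : nat} (r' : nat) (j : jets R r n) : jets R r' n :=
  (j.1, \matrix_(q, i) j.2 (inord q) i).

Definition vel_trunc {r : nat} (r' : nat) (xi : velocities R r n) :
    velocities R r' n :=
  \matrix_(q, a) (xi : 'M[R]_(_, _)) (inord q) a.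

(* x^a_(q), for q <= r *)
Definition vel_coord {r : nat} (xi : velocities R r n) (q : nat)
    (a : 'I_n.+1) : R :=
  (xi : 'M[R]_(_, _)) (inord q) a.

Definition tdot {r : nat} (xi : velocities R r n) : R := vel_coord xi 1 ord0.

Definition xdot {r : nat} (xi : velocities R r n) (i : 'I_n) : R :=
  vel_coord xi 1 (lift ord0 i).

Definition jet_dom (r : nat) (U : set 'rV[R]_n) : set (jets R r n) :=
  [set j | U (row ord0 j.2)].

Definition vel_dom (r : nat) (U : set 'rV[R]_n) : set (velocities R r n) :=
  [set xi | U (\row_i vel_coord xi 0 (lift ord0 i)) /\ tdot xi != 0].

Definition jet_of (r : nat) (X : R -> 'rV[R]_n) (t : R) : jets R r n :=
  (t, \matrix_(q, i) (fun s => X s ord0 i)^`(q) t).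

Definition velocity_of (r : nat) (c : R -> 'rV[R]_n.+1) : velocities R r n :=
  \matrix_(q, a) (fun z => c z ord0 a)^`(q) 0.

Definition time_part (c : R -> 'rV[R]_n.+1) (z : R) : R := c z ord0 ord0.

Definition space_part (c : R -> 'rV[R]_n.+1) (z : R) : 'rV[R]_n :=
  \row_i c z ord0 (lift ord0 i).

(* j is the r-jet at t(0) of X, and xi the velocity at 0 of a parametrized curve
   c = (t, x) whose image is the graph of X, i.e. X (t (zeta)) = x (zeta). *)
Definition represents (r : nat) (xi : velocities R r n) (j : jets R r n) :
    Prop :=
  exists (c : R -> 'rV[R]_n.+1) (X : R -> 'rV[R]_n),
    [/\ smooth_near c 0 /\ velocity_of r c = xi,
        (time_part c)^`() 0 != 0,
        smooth_near X (time_part c 0),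
        \forall z \near (0 : R), X (time_part c z) = space_part c z
      & j = jet_of r X (time_part c 0)].

(* The projection T^r M -> J^r; for r >= 1 its domain is {tdot != 0}, and the
   value is junk elsewhere. *)
Definition wp (r : nat) (xi : velocities R r n) : jets R r n :=
  xget 0 (represents xi).

Definition d_dt {r : nat} (f : jets R r n -> R) : jets R r.+1 n -> R :=
  fun j =>
    'D_((1, 0) : jets R r n) f (jet_trunc r j) +
    \sum_(q < r.+1) \sum_(i < n)
      j.2 (lift ord0 q) i *
      'D_((0, delta_mx q i) : jets R r n) f (jet_trunc r j).

Definition d_dzeta {r : nat} (f : velocities R r n -> R) :
    velocities R r.+1 n -> R :=
  fun xi =>
    \sum_(q < r.+1) \sum_(a < n.+1)
      (xi : 'M[R]_(_, _)) (lift ord0 q) a *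
      'D_(delta_mx q a : velocities R r n) f (vel_trunc r xi).

Fixpoint d_dt_iter (m : nat) {r : nat} (f : jets R r n -> R) :
    jets R (m + r) n -> R :=
  match m with 0%N => f | m'.+1 => d_dt (@d_dt_iter m' r f) end.

Fixpoint d_dzeta_iter (m : nat) {r : nat} (f : velocities R r n -> R) :
    velocities R (m + r) n -> R :=
  match m with 0%N => f | m'.+1 => d_dzeta (@d_dzeta_iter m' r f) end.

(* The m-th term lives on jets (velocities) of order m + k and is pulled back to
   order 2k; the term m = 0 is the plain derivative with respect to x^i (x^a). *)
Definition euler_jet (k : nat) (L : jets R k n -> R) (i : 'I_n) :
    jets R (2 * k) n -> R :=
  fun j =>
    \sum_(m < k.+1) (-1) ^+ m *
      @d_dt_iter m k ('D_((0, delta_mx m i) : jets R k n) L) (jet_trunc (m + k) j).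

Definition euler_vel (k : nat) (L0 : velocities R k n -> R) (a : 'I_n.+1) :
    velocities R (2 * k) n -> R :=
  fun xi =>
    \sum_(m < k.+1) (-1) ^+ m *
      @d_dzeta_iter m k ('D_(delta_mx m a : velocities R k n) L0)
        (vel_trunc (m + k) xi).

End JetsAndVelocities.

(* Main.v *)
From HB Require Import structures.
Require Import Defs.
From mathcomp Require Import all_boot all_order all_algebra.
From mathcomp Require Import all_classical all_reals all_analysis.
From mathcomp Require Import ring lra.
Set Implicit Arguments.
Unset Strict Implicit.
Unset Printing Implicit Defensive.
Import Order.TTheory GRing.Theory Num.Theory.
Import numFieldNormedType.Exports.
Local Open Scope ring_scope.
Local Open Scope classical_set_scope.

(** The proof computes first variations as differential operators in the
    parameter zeta and takes formal adjoints. Write D = d/dzeta, let t' be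
    dt/dzeta, and recall that the adjoint of sum_m a_m D^m sends g to
    sum_m (-1)^m D^m (a_m g). The Euler-Poisson expression of a Lagrange function
    in a variable is the adjoint, at g = 1, of the operator that sends a variation
    of this variable to the first variation of the function ([formal_adj]).

    On the image of the projection d/dt = (1 / t') D, so the projected jet
    coordinates are w_q = ((1 / t') D)^q x ([jet_entry]; [wp_vel_trunc] identifies
    them with the projection). Hence
    - a variation eta of x at fixed t changes w_q by ((1 / t') D)^q eta;
    - a variation eta of t at fixed x changes w_q by
      w_(q+1) eta - ((1 / t') D)^q (w_1 eta).
    The adjoint of (1 / t') D is - D (1 / t'), and
    (- D (1 / t'))^q (t' G) = (-1)^q t' ((1 / t') D)^q G.

    With p_(q,i) the partial derivative of L in w_q^i, the space variation of L t'
    is sum_q t' p_(q,i) ((1 / t') D)^q eta, and its adjoint at 1 is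
    t' sum_q (-1)^q (d/dt)^q p_(q,i), that is t' E_i ([euler_lifted_space]). The
    time variation of L t' is D (L eta) minus the space variations for
    w_1^i eta, because D L = t' (L_t + sum p_(q,i) w_(q+1)^i); its adjoint at 1 is
    - sum_i w_1^i t' E_i = - sum_i u^i E_i ([euler_lifted_time]).

    These computations take place on velocities of one fixed order N = 2k, with D
    the derivative along the vector field that shifts derivatives by one. The
    operator of a variation is found from the commutation of D with partial
    derivatives ([derive_tot]), which rests on the symmetry of second derivatives
    ([smooth_schwarz]), and the two total derivatives are compared by the chain
    rule ([tot_to_jet]). Both need smooth functions to be differentiable and to be
    stable under composition ([C1_frechet], [smooth_comp]).

    For the projection itself, a velocity determines the jet because
    differentiating X (t (zeta)) = x (zeta) recovers the recursion for w_q
    ([jet_along_curve]), and every velocity with t' <> 0 comes from a polynomial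
    curve on a polynomial graph ([represents_exists]). *)

(** * Differentiability of C^1 functions in finitely many coordinates *)

Lemma continuous_bigsum {R : realType} {T : topologicalType}
    {V : normedModType R} (I : Type) (s : seq I) (F : I -> T -> V) (x : T) :
  (forall i, {for x, continuous (F i)}) ->
  {for x, continuous (fun t => \sum_(i <- s) F i t)}.
Proof.
move=> cF; elim: s => [|i s IH].
  rewrite [X in {for x, continuous X}](_ : _ = cst 0); first exact: cvg_cst.
  by apply/funext => t; rewrite big_nil.
rewrite [X in {for x, continuous X}]
  (_ : _ = fun t => F i t + \sum_(j <- s) F j t); first exact: continuousD.
by apply/funext => t; rewrite big_cons.
Qed.

Section Line.
Context {R : realType} {V : normedModType R}.
Implicit Types (f : V -> R) (x v : V).

Lemma is_derive_line f x v (s : R) : derivable f (x + s *: v) v ->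
  is_derive s (1 : R) (fun t : R => f (x + t *: v)) ('D_v f (x + s *: v)).
Proof.
have E : (fun h : R => h^-1 *: (((fun t : R => f (x + t *: v)) \o shift s)
             (h *: (1 : R)) - f (x + s *: v)))
  = (fun h : R => h^-1 *: ((f \o shift (x + s *: v)) (h *: v)
             - f (x + s *: v))).
  apply/funext => h /=; congr (_ *: (f _ - _)).
  by rewrite [_ *: 1]mulr1 scalerDl addrCA.
by move=> df; split; rewrite /derivable /derive E.
Qed.

Lemma MVT_line f x v (a : R) :
  (forall t : R, 0 <= t <= 1 -> derivable f (x + (t * a) *: v) v) ->
  exists2 t, 0 <= t <= 1 &
    f (x + a *: v) - f x = a * 'D_v f (x + (t * a) *: v).
Proof.
move=> df.
pose g (t : R) := f (x + (t * a) *: v).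
have dg (t : R) : 0 <= t <= 1 -> is_derive t (1 : R) g (a * 'D_v f (x + (t * a) *: v)).
  move=> t01; have h1 := is_derive_line (df t t01).
  have h2 : is_derive t (1 : R) (fun t : R => t * a) a.
    by apply: is_derive_eq; rewrite scaler0 add0r [_ *: 1]mulr1.
  have := @is_derive1_comp _ (fun t : R => f (x + t *: v)) (fun t : R => t * a)
     t _ _ h1 h2.
  by rewrite mulrC.
have dg' (t : R) : t \in `]0, 1[%R -> is_derive t (1 : R) g (a * 'D_v f (x + (t * a) *: v)).
  by rewrite in_itv /= => /andP[/ltW t0 /ltW t1]; apply: dg; rewrite t0.
have gc : {within `[0, 1], continuous g}.
  apply: derivable_within_continuous => t; rewrite in_itv /= => t01.
  by have [] := dg t t01.
have [t] := MVT_segment ler01 dg' gc.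
rewrite in_itv /= => t01; rewrite /g mul1r mul0r scale0r addr0 subr0 mulr1.
by exists t.
Qed.

End Line.

(** A finite system of linear coordinates. It lets matrices and the product
    R x matrices, the two kinds of spaces at hand, share one calculus. *)
Record frame (R : realType) (V : normedModType R) := Frame {
  frame_index : finType;
  fbasis : frame_index -> V;
  fcoord : frame_index -> {linear V -> R};
  fcoord_cont : forall j, continuous (fcoord j);
  frameK : forall h, h = \sum_j fcoord j h *: fbasis j }.
Arguments fbasis {R V} f j.
Arguments fcoord {R V} f j.

Section Frechet.
Context {R : realType} {V : normedModType R} (B : frame V).
Implicit Types (D : set V) (f : V -> R) (x v h : V).

Local Notation partial_sum s h := (\sum_(j <- s) fcoord B j h *: fbasis B j).

Lemma partial_sum_lip (s : seq (frame_index B)) :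
  exists2 k, 0 < k & forall h, `|partial_sum s h| <= k * `|h|.
Proof.
elim: s => [|j s [k k0 IH]].
  by exists 1 => // h; rewrite big_nil normr0 mul1r.
have [l l0 lP] := linear_lipschitz (@fcoord_cont _ _ B j).
exists (l * `|fbasis B j| + k); first by rewrite ltr_wpDl// mulr_ge0// ltW.
move=> h; rewrite big_cons (le_trans (ler_normD _ _))// mulrDl lerD//.
by rewrite normrZ mulrAC ler_wpM2r.
Qed.

(** Each summand is moved along one basis vector, so the mean value theorem
    on a segment and the continuity of that partial derivative suffice; the
    induction adds one coordinate at a time. *)
Lemma partial_sum_increment D f x (s : seq (frame_index B)) :
  open D -> D x ->
  (forall j y, D y -> derivable f y (fbasis B j)) ->
  (forall j, {for x, continuous ('D_(fbasis B j) f)}) ->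
  forall e : R, 0 < e -> \forall h \near (0 : V),
    `|f (x + partial_sum s h) - f x
      - \sum_(j <- s) fcoord B j h * 'D_(fbasis B j) f x| <= e * `|h|.
Proof.
move=> oD Dx df cf; elim: s => [|j s IH] e e0.
  by near=> h; rewrite !big_nil addr0 subrr subr0 normr0 mulr_ge0// ltW.
have [k k0 kP] := partial_sum_lip s.
have [l l0 lP] := linear_lipschitz (@fcoord_cont _ _ B j).
have le0 : 0 < e / 2 / l by rewrite !divr_gt0.
have /nbhs_ballP[d /= d0 dP] : \forall y \near x, D y /\
    `|'D_(fbasis B j) f x - 'D_(fbasis B j) f y| <= e / 2 / l.
  near=> y; split; first by near: y; exact: open_nbhs_nbhs.
  by near: y; exact: (cvgr_dist_le _ _ (cf j)).
near=> h.
pose y := x + partial_sum s h.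
have seg (t : R) : 0 <= t <= 1 -> ball x d (y + (t * fcoord B j h) *: fbasis B j).
  case/andP => t0 t1; rewrite -ball_normE /= /y -addrA opprD addrA subrr add0r normrN.
  apply: (@le_lt_trans _ _ ((k + l * `|fbasis B j|) * `|h|)).
    rewrite (le_trans (ler_normD _ _))// mulrDl lerD// normrZ normrM [leRHS]mulrAC.
    rewrite ler_wpM2r// -[leRHS]mul1r ler_pM// ger0_norm//.
  rewrite mulrC -ltr_pdivlMr; last by rewrite ltr_pwDl// mulr_ge0// ltW.
  near: h; apply: nbhs0_lt; rewrite divr_gt0//.
  by rewrite ltr_pwDl// mulr_ge0// ltW.
have [t t01 tE] := MVT_line (fun t ht => df j _ (dP _ (seg t ht)).1).
rewrite !big_cons [_ *: _ + _]addrC addrA -/y.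
have -> : f (y + fcoord B j h *: fbasis B j) - f x
     - (fcoord B j h * 'D_(fbasis B j) f x
        + \sum_(i <- s) fcoord B i h * 'D_(fbasis B i) f x)
   = (f (y + fcoord B j h *: fbasis B j) - f y - fcoord B j h * 'D_(fbasis B j) f x)
     + (f y - f x - \sum_(i <- s) fcoord B i h * 'D_(fbasis B i) f x) by ring.
rewrite tE -mulrBr (le_trans (ler_normD _ _))// (splitr e) mulrDl lerD//; last first.
  by rewrite /y; near: h; apply: IH; rewrite divr_gt0.
have -> : e / 2 * `|h| = (l * `|h|) * (e / 2 / l) by field; lra.
by rewrite normrM ler_pM// distrC; exact: (dP _ (seg t t01)).2.
Unshelve. all: by end_near. Qed.

Lemma C1_frechet D f x :
  open D -> D x ->
  (forall j y, D y -> derivable f y (fbasis B j)) ->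
  (forall j, {for x, continuous ('D_(fbasis B j) f)}) ->
  differentiable f x /\
  forall v, 'd f x v = \sum_j fcoord B j v * 'D_(fbasis B j) f x.
Proof.
move=> oD Dx df cf.
pose d v : R := \sum_j fcoord B j v * 'D_(fbasis B j) f x.
have lin_d : linear d.
  move=> a u v; rewrite /d scaler_sumr -big_split; apply: eq_bigr => j _ /=.
  by rewrite linearP /= mulrDl -mulrA.
pose dL : {linear V -> R} := HB.pack d (GRing.isLinear.Build _ _ _ _ _ lin_d).
have dc : continuous dL.
  move=> v; apply: continuous_bigsum => j.
  by apply: continuousM; [exact: fcoord_cont|exact: cvg_cst].
have E : f \o shift x = cst (f x) + dL +o_ (0 : V) id.
  apply/eqaddoP => e e0; near=> h.
  rewrite -[X in `|X|]/(f (h + x) - (f x + d h)) opprD addrA [h + x]addrC.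
  rewrite {1}[h](frameK B).
  near: h; exact: (partial_sum_increment (index_enum _) oD Dx df cf).
have dE := diff_unique dc E; split; last by move=> v; rewrite dE.
by apply/diff_locallyP; rewrite dE; split.
Unshelve. all: by end_near. Qed.

End Frechet.

(** * Chain rule and closure properties of smooth functions *)

Section ChainRule.
Context {R : realType} {V W : normedModType R}.

Lemma is_derive_lineP (f : V -> W) x v df :
  is_derive x v f df <-> is_derive (0 : R) (1 : R) (fun h : R => f (h *: v + x)) df.
Proof.
have E : (fun h : R => h^-1 *: ((f \o shift x) (h *: v) - f x)) =
   (fun h : R => h^-1 *: (((fun h : R => f (h *: v + x)) \o shift 0) (h *: (1 : R))
       - f (0 *: v + x))).
  by apply/funext => h /=; rewrite addr0 scale0r add0r [_ *: 1]mulr1.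
by split; case=> df1 df2; split; move: df1 df2; rewrite /derivable /derive E.
Qed.

Lemma diff_bigsumZl (I : Type) (s : seq I) (k : I -> V -> R) (w : I -> W) x :
  (forall i, differentiable (k i) x) ->
  differentiable (fun y => \sum_(i <- s) k i y *: w i) x /\
  forall v, 'd (fun y => \sum_(i <- s) k i y *: w i) x v =
     \sum_(i <- s) 'd (k i) x v *: w i.
Proof.
move=> dk; elim: s => [|i s [IH1 IH2]].
  rewrite (_ : (fun _ => _) = cst 0); last by apply/funext => y; rewrite big_nil.
  by split=> [|v]; [exact: differentiable_cst|rewrite diff_cst big_nil].
rewrite (_ : (fun _ => _) = (fun y => k i y *: w i) +
    (fun y => \sum_(j <- s) k j y *: w j)); last first.
  by apply/funext => y; rewrite big_cons.
have dZ : differentiable (fun y => k i y *: w i) x by exact: differentiableZl.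
split; first exact: differentiableD.
by move=> v; rewrite diffD// big_cons -IH2 diffZl.
Qed.

End ChainRule.

Section ChainRuleFrame.
Context {R : realType} {V W : normedModType R} (B : frame W).

(** Only differentiability of [phi] along the line through [x] is needed, which
    is what derivability of its coordinates gives: on that line [phi] is a curve,
    and for curves derivable and differentiable coincide. *)
Lemma is_derive_frame_comp (g : W -> R) (phi : V -> W) x v :
  differentiable g (phi x) ->
  (forall j, derivable (fcoord B j \o phi) x v) ->
  is_derive x v (g \o phi)
   (\sum_j 'D_v (fcoord B j \o phi) x * 'D_(fbasis B j) g (phi x)).
Proof.
move=> dg dphi; apply/is_derive_lineP.
pose gamma (h : R) := phi (h *: v + x).
have dc j : is_derive (0 : R) (1 : R) (fcoord B j \o gamma) ('D_v (fcoord B j \o phi) x).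
  by apply/(is_derive_lineP (fcoord B j \o phi)); exact: derivableP.
have dc' j : differentiable (fcoord B j \o gamma) (0 : R).
  by apply/derivable1_diffP; case: (dc j).
have gE : gamma = fun h => \sum_j (fcoord B j \o gamma) h *: fbasis B j.
  by apply/funext => h; exact: frameK.
have [dga dgE] := diff_bigsumZl (index_enum (frame_index B)) (fbasis B) dc'.
rewrite -gE in dga dgE.
have g0 : gamma 0 = phi x by rewrite /gamma scale0r add0r.
have dgg : differentiable g (gamma 0) by rewrite g0.
have dcomp : differentiable (g \o gamma) (0 : R) by exact: differentiable_comp.
split; first exact/derivable1_diffP.
rewrite -[LHS]/('D_1 (g \o gamma) 0) deriveE// diff_comp// /= dgE linear_sum.
apply: eq_bigr => j _; rewrite linearZ /= g0.
have [_ <-] := dc j.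
by rewrite [in RHS]deriveE// [in RHS]deriveE.
Qed.

End ChainRuleFrame.

Section Smoothness.
Context {R : realType} {V : normedModType R} (B : frame V) (D : set V).
Hypothesis oD : open D.
Implicit Types (f g : V -> R) (x v h : V).

Lemma Cn_on_ext p f g : (forall x, D x -> f x = g x) -> Cn_on p D f -> Cn_on p D g.
Proof.
have nearD (h1 h2 : V -> R) x : (forall x, D x -> h1 x = h2 x) -> D x -> {near x, h1 =1 h2}.
  by move=> h12 Dx; apply: filterS (open_nbhs_nbhs (conj oD Dx)) => y; exact: h12.
elim: p f g => [|p IH] f g fg /=.
  move=> cf x Dx; have := cf x Dx; rewrite /prop_for /continuous_at (fg x Dx) => H.
  by apply: cvg_trans H; apply: near_eq_cvg; exact: nearD.
move=> Cf v; split=> [x Dx|].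
  by apply: near_eq_derivable ((Cf v).1 x Dx); exact: nearD.
by apply: IH (Cf v).2 => x Dx; apply: near_eq_derive; exact: nearD.
Qed.

Lemma Cn_on1_frechet f x : Cn_on 1 D f -> D x ->
  differentiable f x /\ forall v, 'd f x v = \sum_j fcoord B j v * 'D_(fbasis B j) f x.
Proof.
move=> Cf Dx; apply: (C1_frechet oD Dx).
  by move=> j y Dy; exact: (Cf _).1.
by move=> j; exact: (Cf (fbasis B j)).2.
Qed.

(** [Cn_on] asks for continuity at the last order only; continuity at lower
    orders comes from differentiability, hence from the finitely many
    coordinates. *)
Lemma Cn_onW p f : Cn_on p.+1 D f -> Cn_on p D f.
Proof.
elim: p f => [|p IH] f Cf.
  by move=> x Dx; apply: differentiable_continuous; case: (Cn_on1_frechet Cf Dx).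
by move=> v; split; [exact: (Cf v).1|exact: IH (Cf v).2].
Qed.

Lemma Cn_on_cst p (a : R) : Cn_on p D (fun=> a).
Proof.
elim: p a => [|p IH] a /=; first by move=> x _; exact: cst_continuous.
move=> v; split; first by move=> x _; exact: derivable_cst.
by rewrite (_ : 'D_v _ = fun=> 0) //; apply/funext => x; exact: derive_cst.
Qed.

Lemma Cn_onD p f g : Cn_on p D f -> Cn_on p D g -> Cn_on p D (fun x => f x + g x).
Proof.
elim: p f g => [|p IH] f g Cf Cg /=.
  by move=> x Dx; apply: continuousD; [exact: Cf|exact: Cg].
move=> v; split; first by move=> x Dx; apply: derivableD; [exact: (Cf v).1|exact: (Cg v).1].
apply: Cn_on_ext (IH _ _ (Cf v).2 (Cg v).2) => x Dx.
by rewrite deriveD //; [exact: (Cf v).1|exact: (Cg v).1].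
Qed.

Lemma Cn_onM p f g : Cn_on p D f -> Cn_on p D g -> Cn_on p D (fun x => f x * g x).
Proof.
elim: p f g => [|p IH] f g Cf Cg /=.
  by move=> x Dx; apply: continuousM; [exact: Cf|exact: Cg].
move=> v; split; first by move=> x Dx; apply: derivableM; [exact: (Cf v).1|exact: (Cg v).1].
apply: Cn_on_ext (Cn_onD (IH _ _ (Cn_onW Cf) (Cg v).2) (IH _ _ (Cn_onW Cg) (Cf v).2)).
by move=> x Dx; rewrite deriveM //; [exact: (Cf v).1|exact: (Cg v).1].
Qed.

(** The derivative of [1 / f] contains [1 / f] again, so the induction is on the
    order, with the product rule applied at that same order. *)
Lemma Cn_onV p f : (forall x, D x -> f x != 0) ->
  Cn_on p D f -> Cn_on p D (fun x => (f x)^-1).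
Proof.
move=> f0; elim: p => [|p IH] Cf /=.
  by move=> x Dx; apply: continuousV; [exact: f0|exact: Cf].
have CV := IH (Cn_onW Cf).
move=> v; split; first by move=> x Dx; apply: derivableV; [exact: f0|exact: (Cf v).1].
apply: Cn_on_ext (Cn_onM (Cn_on_cst p (-1)) (Cn_onM (Cn_onM CV CV) (Cf v).2)).
move=> x Dx; rewrite deriveV //; [|exact: f0|exact: (Cf v).1].
by rewrite mulN1r -invfM -expr2 scaleNr.
Qed.

Lemma smooth_ext f g : (forall x, D x -> f x = g x) -> smooth_on D f -> smooth_on D g.
Proof. by move=> fg sf p; exact: Cn_on_ext (sf p). Qed.

Lemma smooth_cst (a : R) : smooth_on D (fun=> a).
Proof. by move=> p; exact: Cn_on_cst. Qed.

Lemma smoothD f g : smooth_on D f -> smooth_on D g -> smooth_on D (fun x => f x + g x).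
Proof. by move=> sf sg p; exact: Cn_onD. Qed.

Lemma smoothM f g : smooth_on D f -> smooth_on D g -> smooth_on D (fun x => f x * g x).
Proof. by move=> sf sg p; exact: Cn_onM. Qed.

Lemma smoothV f : (forall x, D x -> f x != 0) -> smooth_on D f ->
  smooth_on D (fun x => (f x)^-1).
Proof. by move=> f0 sf p; exact: Cn_onV. Qed.

Lemma smoothN f : smooth_on D f -> smooth_on D (fun x => - f x).
Proof.
move=> sf; apply: smooth_ext (smoothM (smooth_cst (-1)) sf) => x _.
by rewrite mulN1r.
Qed.

Lemma smooth_bigsum (I : Type) (s : seq I) (F : I -> V -> R) :
  (forall i, smooth_on D (F i)) -> smooth_on D (fun x => \sum_(i <- s) F i x).
Proof.
move=> sF; elim: s => [|i s IH].
  by apply: smooth_ext (smooth_cst 0) => x _; rewrite big_nil.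
by apply: smooth_ext (smoothD (sF i) IH) => x _; rewrite big_cons.
Qed.

Lemma smooth_derive f v : smooth_on D f -> smooth_on D ('D_v f).
Proof. by move=> sf p; exact: (sf p.+1 v).2. Qed.

Lemma smooth_derivable f x v : smooth_on D f -> D x -> derivable f x v.
Proof. by move=> sf Dx; exact: (sf 1%N v).1. Qed.

Lemma smooth_differentiable f x : smooth_on D f -> D x -> differentiable f x.
Proof. by move=> sf Dx; case: (Cn_on1_frechet (sf 1%N) Dx). Qed.

Lemma smooth_continuous f x : smooth_on D f -> D x -> {for x, continuous f}.
Proof. by move=> sf; exact: (sf 0%N). Qed.

Lemma smooth_linear (l : {linear V -> R}) : continuous l -> smooth_on D l.
Proof.
move=> cl [|p]; first by move=> x _; exact: cl.
move=> v; have dl x : differentiable l x by exact: linear_differentiable.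
split; first by move=> x _; exact: diff_derivable.
apply: Cn_on_ext (Cn_on_cst p (l v)) => x Dx.
by rewrite deriveE// diff_lin.
Qed.

End Smoothness.

Section SmoothComp.
Context {R : realType} {V W : normedModType R} (B : frame V) (C : frame W).
Context (D : set V) (D' : set W).
Hypotheses (oD : open D) (oD' : open D').

Lemma smooth_comp (g : W -> R) (phi : V -> W) :
  (forall x, D x -> D' (phi x)) ->
  (forall j, smooth_on D (fcoord C j \o phi)) ->
  smooth_on D' g -> smooth_on D (g \o phi).
Proof.
move=> Dphi sphi sg p; elim: p g sg => [|p IH] g sg.
  move=> x Dx; apply: continuous_comp; last exact: (smooth_continuous sg (Dphi x Dx)).
  rewrite (_ : phi = fun y => \sum_j (fcoord C j \o phi) y *: fbasis C j); last first.
    by apply/funext => y; exact: frameK.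
  apply: differentiable_continuous.
  apply: (diff_bigsumZl _ (fbasis C) _).1 => j.
  exact: (smooth_differentiable B oD).
move=> v.
have dd x : D x -> is_derive x v (g \o phi)
   (\sum_j 'D_v (fcoord C j \o phi) x * 'D_(fbasis C j) g (phi x)).
  move=> Dx; apply: is_derive_frame_comp.
    by apply: (smooth_differentiable C oD' sg); exact: Dphi.
  by move=> j; exact: (smooth_derivable (sphi j)).
split; first by move=> x /dd[].
pose F (j : frame_index C) x := 'D_v (fcoord C j \o phi) x * 'D_(fbasis C j) g (phi x).
have H j : Cn_on p D (F j).
  apply: (Cn_onM B oD); first exact: (smooth_derive _ (sphi j)).
  exact: IH (smooth_derive _ sg).
apply: (@Cn_on_ext _ _ D oD p (fun x => \sum_j F j x)).
  by move=> x /dd[].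
elim: (index_enum _) => [|j s IHs].
  by apply: (Cn_on_ext oD) (Cn_on_cst D p 0) => x _; rewrite big_nil.
by apply: (Cn_on_ext oD) (Cn_onD oD (H j) IHs) => x _; rewrite big_cons.
Qed.

End SmoothComp.

(** * Symmetry of second derivatives *)

Section Schwarz.
Context {R : realType} {V : normedModType R} (B : frame V) (D : set V).
Hypothesis oD : open D.
Implicit Types (f g : V -> R) (x y u v w : V).

Lemma is_derive_translate f w y u : derivable f (y + w) u ->
  is_derive y u (fun z => f (z + w)) ('D_u f (y + w)).
Proof.
have E : (fun h : R => h^-1 *: (((fun z => f (z + w)) \o shift y) (h *: u) - f (y + w)))
  = (fun h : R => h^-1 *: ((f \o shift (y + w)) (h *: u) - f (y + w))).
  by apply/funext => h /=; rewrite addrA.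
by move=> df; split; rewrite /derivable /derive E.
Qed.

(** The mean value theorem is applied along [u] to the difference of [f] and its
    translate by [t *: v], then along [v] to ['D_u f]. *)
Lemma second_difference f x u v (t : R) : smooth_on D f ->
  (forall r s : R, 0 <= r <= 1 -> 0 <= s <= 1 -> D (x + (r * t) *: u + (s * t) *: v)) ->
  exists r s : R, [/\ 0 <= r <= 1, 0 <= s <= 1 &
    f (x + t *: u + t *: v) - f (x + t *: u) - (f (x + t *: v) - f x)
    = t ^+ 2 * 'D_v ('D_u f) (x + (r * t) *: u + (s * t) *: v)].
Proof.
move=> sf DD.
have i0 : 0 <= (0 : R) <= 1 by rewrite lexx ler01.
have i1 : 0 <= (1 : R) <= 1 by rewrite lexx ler01.
pose g y := f (y + t *: v) - f y.
have dg (r : R) : 0 <= r <= 1 -> is_derive (x + (r * t) *: u) u g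
    ('D_u f (x + (r * t) *: u + t *: v) - 'D_u f (x + (r * t) *: u)).
  move=> hr; have D1 : D (x + (r * t) *: u + t *: v) by have := DD r 1 hr i1; rewrite mul1r.
  have D0 : D (x + (r * t) *: u) by have := DD r 0 hr i0; rewrite mul0r scale0r addr0.
  apply: is_deriveB; first by apply: is_derive_translate; exact: (smooth_derivable sf).
  by apply: derivableP; exact: (smooth_derivable sf).
have [r hr rE] := MVT_line (fun r hr => @ex_derive _ _ _ _ _ _ _ (dg r hr)).
have [s hs sE] := @MVT_line _ _ ('D_u f) (x + (r * t) *: u) v t
  (fun s hs => smooth_derivable (smooth_derive u sf) (DD r s hr hs)).
exists r, s; split => //.
transitivity (g (x + t *: u) - g x) => //.
by rewrite rE (derive_val (is_derive := dg r hr)) sE expr2 mulrA.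
Qed.

(** The second difference of the previous lemma is symmetric in [u] and [v], so
    the two mixed derivatives agree at points arbitrarily close to [x]. *)
Lemma smooth_schwarz f x u v : smooth_on D f -> D x ->
  'D_u ('D_v f) x = 'D_v ('D_u f) x.
Proof.
move=> sf Dx; apply/eqP; rewrite -subr_eq0 -normr_le0; apply/ler_addgt0Pr => e e0.
have cvu := smooth_continuous (smooth_derive v (smooth_derive u sf)) Dx.
have cuv := smooth_continuous (smooth_derive u (smooth_derive v sf)) Dx.
have e20 : 0 < e / 2 by rewrite divr_gt0.
have nuv := @cvgr_dist_le _ _ _ _ (nbhs_filter x) _ _ cuv _ e20.
have nvu := @cvgr_dist_le _ _ _ _ (nbhs_filter x) _ _ cvu _ e20.
have near_x : \forall y \near x, D y /\
    (`|'D_u ('D_v f) x - 'D_u ('D_v f) y| <= e / 2 /\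
     `|'D_v ('D_u f) x - 'D_v ('D_u f) y| <= e / 2).
  exact: (filterI (open_nbhs_nbhs (conj oD Dx)) (filterI nuv nvu)).
have /nbhs_ballP[d /= d0 dP] := near_x.
(* The parallelogram on [t *: u] and [t *: v] has to stay in the ball. *)
have [t t0 tP] : exists2 t : R, 0 < t & t * (`|u| + `|v|) < d.
  have n0 : 0 < `|u| + `|v| + 1 by rewrite ltr_wpDl// addr_ge0.
  exists (d / (`|u| + `|v| + 1) / 2); first by rewrite !divr_gt0.
  apply: (@le_lt_trans _ _ (d / (`|u| + `|v| + 1) / 2 * (`|u| + `|v| + 1))).
    by rewrite ler_wpM2l ?lerDl// !mulr_ge0 ?invr_ge0// ltW.
  have -> : d / (`|u| + `|v| + 1) / 2 * (`|u| + `|v| + 1) = d / 2.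
    by field; rewrite gt_eqF.
  by lra.
have bP (r s : R) : 0 <= r <= 1 -> 0 <= s <= 1 ->
    ball x d (x + (r * t) *: u + (s * t) *: v).
  case/andP=> r0 r1 /andP[s0 s1].
  rewrite -ball_normE /= -addrA opprD addrA subrr add0r normrN.
  apply: le_lt_trans tP; rewrite (le_trans (ler_normD _ _))// mulrDr.
  rewrite !normrZ (ger0_norm r0) (ger0_norm s0) (gtr0_norm t0).
  by rewrite lerD// ler_wpM2r// ler_piMl// (ltW t0).
have [p [q [hp hq E1]]] :=
  second_difference sf (fun _ _ hr hs => (dP _ (bP _ _ hr hs)).1).
have bP' (r s : R) : 0 <= r <= 1 -> 0 <= s <= 1 ->
    ball x d (x + (r * t) *: v + (s * t) *: u).
  by move=> hr' hs'; rewrite addrAC; exact: bP.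
have [p' [q' [hp' hq' E2]]] :=
  second_difference sf (fun _ _ hr hs => (dP _ (bP' _ _ hr hs)).1).
have EE : 'D_v ('D_u f) (x + (p * t) *: u + (q * t) *: v) =
          'D_u ('D_v f) (x + (p' * t) *: v + (q' * t) *: u).
  apply: (@mulfI _ (t ^+ 2)); first by rewrite expf_neq0// gt_eqF.
  by rewrite -E1 -E2 [x + t *: v + t *: u]addrAC; ring.
have [_ [_ h1]] := dP _ (bP p q hp hq).
have [_ [h2 _]] := dP _ (bP' p' q' hp' hq').
rewrite add0r (splitr e); apply: le_trans (lerD h2 h1).
rewrite EE [X in _ <= _ + X]distrC; apply: le_trans (ler_normD _ _).
by rewrite addrA subrK.
Qed.

End Schwarz.

(** * Coordinates on jets and velocities *)

Lemma big_option (V : nmodType) (T : finType) (F : option T -> V) :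
  \sum_(x : option T) F x = F None + \sum_(x : T) F (Some x).
Proof.
rewrite (bigD1 None) //=; congr (_ + _).
rewrite (reindex_omap Some id) /=; last by case.
by apply: eq_bigl => x; rewrite eqxx.
Qed.

Section Frames.
Context {R : realType} {n : nat}.

Definition mx_entry (m p : nat) (i : 'I_m) (j : 'I_p) (M : 'M[R]_(m, p)) : R := M i j.

Lemma mx_entry_is_linear m p (i : 'I_m) (j : 'I_p) : linear (mx_entry i j).
Proof. by move=> a M M'; rewrite /mx_entry !mxE. Qed.

HB.instance Definition _ m p (i : 'I_m) (j : 'I_p) :=
  GRing.isLinear.Build R 'M[R]_(m, p) R *:%R (mx_entry i j) (mx_entry_is_linear i j).

Definition mx_frame (m p : nat) : frame 'M[R]_(m, p).
Proof.
refine (@Frame R 'M[R]_(m, p) ('I_m * 'I_p)%type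
  (fun p => delta_mx p.1 p.2) (fun p => mx_entry p.1 p.2) _ _).
- by move=> ij; exact: coord_continuous.
- by move=> h; rewrite {1}[h]matrix_sum_delta pair_bigA.
Defined.

Definition vel_frame (r : nat) : frame (velocities R r n) :=
  mx_frame r.+1 n.+1.

Definition jet_coord (r : nat) (p : option ('I_r.+1 * 'I_n)) (j : jets R r n) : R :=
  if p is Some p then j.2 p.1 p.2 else j.1.

Lemma jet_coord_is_linear r p : linear (@jet_coord r p).
Proof. by case: p => [p|] a j j' /=; rewrite ?mxE. Qed.

HB.instance Definition _ r p :=
  GRing.isLinear.Build R (jets R r n) R *:%R (@jet_coord r p) (jet_coord_is_linear p).

Definition jet_frame (r : nat) : frame (jets R r n).
Proof.
refine (@Frame R (jets R r n) (option ('I_r.+1 * 'I_n))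
  (fun p => if p is Some p then (0, delta_mx p.1 p.2) else (1, 0))
  (fun p => (@jet_coord r p : {linear jets R r n -> R})) _ _).
- move=> [p|] j; last exact: cvg_fst.
  apply: (@continuous_comp _ _ _ snd (fun M : 'M[R]_(r.+1, n) => M p.1 p.2)).
    exact: cvg_snd.
  exact: coord_continuous.
- move=> [t M]; rewrite big_option /=; congr (_, _) => /=.
  + rewrite [in RHS](big_morph fst (id1 := 0) (op1 := +%R)) //=.
    rewrite big1 ?addr0 ?[_ *: 1]mulr1//.
    by move=> p _; rewrite scaler0.
  + rewrite [in RHS](big_morph snd (id1 := 0) (op1 := +%R)) //= scaler0 add0r.
    by rewrite {1}[M]matrix_sum_delta pair_bigA.
Defined.

End Frames.

Lemma frame_continuous {R : realType} {T : topologicalType} {W : normedModType R}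
    (C : frame W) (phi : T -> W) x :
  (forall j, {for x, continuous (fcoord C j \o phi)}) -> {for x, continuous phi}.
Proof.
move=> cphi.
have -> : phi = fun y => \sum_j (fcoord C j \o phi) y *: fbasis C j.
  by apply/funext => y; exact: frameK.
apply: continuous_bigsum => j.
apply: (@continuous_comp _ _ _ (fcoord C j \o phi) (fun k : R => k *: fbasis C j)).
  exact: cphi.
exact: scalel_continuous.
Qed.

Section LinearPrecomp.
Context {R : realType} {V W : normedModType R}.

Lemma is_derive_linear (l : {linear V -> R}) x v : continuous l ->
  is_derive x v l (l v).
Proof.
move=> cl; have dl : differentiable l x by exact: linear_differentiable.
by split; [exact: diff_derivable|rewrite deriveE// diff_lin].
Qed.

(** Precomposition with a linear map does not change difference quotients, so
    the resulting rules hold with no regularity assumption on [f]. *)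
Lemma quotient_linear (f : W -> R) (l : V -> W) x v : linear l ->
  (fun h : R => h^-1 *: (((f \o l) \o shift x) (h *: v) - (f \o l) x)) =
  (fun h : R => h^-1 *: ((f \o shift (l x)) (h *: l v) - f (l x))).
Proof. by move=> ll; apply/funext => h /=; rewrite ll. Qed.

Lemma derive_linear_precomp (f : W -> R) (l : V -> W) x v : linear l ->
  'D_v (f \o l) x = 'D_(l v) f (l x).
Proof. by move=> ll; rewrite /derive quotient_linear. Qed.

Lemma derivable_linear_precomp (f : W -> R) (l : V -> W) x v : linear l ->
  derivable (f \o l) x v <-> derivable f (l x) (l v).
Proof. by move=> ll; rewrite /derivable quotient_linear. Qed.

Lemma smooth_linear_precomp (D : set V) (D' : set W) (f : W -> R) (l : V -> W) :
  linear l -> continuous l -> (forall x, D x -> D' (l x)) ->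
  smooth_on D' f -> smooth_on D (f \o l).
Proof.
move=> ll cl lD sf p; elim: p f sf => [|p IH] f sf.
  move=> x Dx; apply: continuous_comp; first exact: cl.
  by apply: (smooth_continuous sf); exact: lD.
move=> v; split.
  move=> x Dx; apply/(derivable_linear_precomp _ _ _ ll).
  by apply: (smooth_derivable sf); exact: lD.
have -> : 'D_v (f \o l) = 'D_(l v) f \o l.
  by apply/funext => x; exact: derive_linear_precomp.
by apply: IH; exact: smooth_derive.
Qed.

End LinearPrecomp.

Section Domains.
Context {R : realType} {n : nat}.

Lemma vel_coord_linear r q a : linear (fun xi : velocities R r n => vel_coord xi q a).
Proof. by move=> c x y; rewrite /vel_coord !mxE. Qed.

Lemma vel_coord_continuous r q a :
  continuous (fun xi : velocities R r n => vel_coord xi q a).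
Proof. by move=> xi; exact: coord_continuous. Qed.

Lemma smooth_vel_coord r q a (D : set (velocities R r n)) :
  open D -> smooth_on D (fun xi => vel_coord xi q a).
Proof.
move=> oD; apply: (@smooth_linear _ _ _ oD (mx_entry (inord q) a)).
exact: coord_continuous.
Qed.

Lemma is_derive_vel_coord r q a (xi v : velocities R r n) :
  is_derive xi v (fun xi => vel_coord xi q a) (vel_coord v q a).
Proof.
apply: (is_derive_linear (l := mx_entry (inord q) a)).
exact: coord_continuous.
Qed.

Lemma vel_dom_open r (U : set 'rV[R]_n) : open U -> open (@vel_dom R n r U).
Proof.
move=> oU; apply: openI.
  apply: (@open_comp _ _
    (fun xi : velocities R r n => \row_i vel_coord xi 0 (lift ord0 i)) U) => //.
  move=> xi _; apply: (frame_continuous (C := mx_frame 1 n)) => -[i j].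
  rewrite (_ : _ \o _ = fun xi : velocities R r n => vel_coord xi 0 (lift ord0 j)).
    exact: vel_coord_continuous.
  by apply/funext => y /=; rewrite /mx_entry mxE.
apply: (@open_comp _ _ (fun xi : velocities R r n => tdot xi) [set x | x != 0]).
  by move=> xi _; exact: vel_coord_continuous.
exact: open_neq.
Qed.

Lemma jet_dom_open r (U : set 'rV[R]_n) : open U -> open (@jet_dom R n r U).
Proof.
move=> oU; apply: (@open_comp _ _ (fun j : jets R r n => row ord0 j.2) U) => //.
move=> xi _; apply: (frame_continuous (C := mx_frame 1 n)) => -[i j].
rewrite (_ : _ \o _ = fcoord (jet_frame r) (Some (ord0, j))).
  exact: fcoord_cont.
by apply/funext => y /=; rewrite /mx_entry mxE.
Qed.

End Domains.

(** * The total derivative along the parameter *)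

Lemma is_derive_bigsum {R : realType} {V : normedModType R} (I : Type) (s : seq I)
    (F : I -> V -> R) (dF : I -> R) x v :
  (forall i, is_derive x v (F i) (dF i)) ->
  is_derive x v (fun y => \sum_(i <- s) F i y) (\sum_(i <- s) dF i).
Proof.
move=> HF; elim: s => [|i s IH].
  rewrite big_nil (_ : (fun _ => _) = cst 0); first exact: is_derive_cst.
  by apply/funext => y; rewrite big_nil.
rewrite big_cons (_ : (fun _ => _) = F i + (fun y => \sum_(j <- s) F j y)).
  exact: is_deriveD.
by apply/funext => y; rewrite big_cons.
Qed.

Section TotalDerivative.
Context {R : realType} {n N : nat}.
Local Notation V := (velocities R N n).
Implicit Types (f g : V -> R) (xi v : V).

(** The vector field of the total derivative: every derivative moves to the next
    one. On velocities of fixed order [N] the row [N] has no successor, whence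
    the zero; functions of the rows below [N] do not see it. *)
Definition vshift (xi : V) : V :=
  \matrix_(q, a) (if (q < N)%N then vel_coord xi q.+1 a else 0).

(** Seeing d/dzeta as the derivative in the direction of a vector field gives it
    the sum and product rules of directional derivatives at once. *)
Definition total_derivative (f : V -> R) (xi : V) : R := 'D_(vshift xi) f xi.
Local Notation tot := total_derivative.

Lemma vel_coord_vshift xi q a : (q < N)%N ->
  vel_coord (vshift xi) q a = vel_coord xi q.+1 a.
Proof. by move=> qN; rewrite {1}/vel_coord mxE inordK ?qN// ltnS ltnW. Qed.

Lemma is_derive_vshift_entry (p : 'I_N.+1 * 'I_n.+1) xi v :
  is_derive xi v (fun xi : V => vshift xi p.1 p.2) (vshift v p.1 p.2).
Proof.
case: (ltnP p.1 N) => pN.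
  rewrite mxE pN (_ : (fun _ => _) = fun xi : V => vel_coord xi p.1.+1 p.2).
    exact: is_derive_vel_coord.
  by apply/funext => y; rewrite mxE pN.
rewrite mxE ltnNge pN (_ : (fun _ => _) = cst 0); first exact: is_derive_cst.
by apply/funext => y; rewrite mxE ltnNge pN.
Qed.

Variable D : set V.
Hypothesis oD : open D.

Lemma totE f xi : smooth_on D f -> D xi ->
  tot f xi = \sum_(p : 'I_N.+1 * 'I_n.+1) vshift xi p.1 p.2 * 'D_(delta_mx p.1 p.2) f xi.
Proof.
move=> sf Dxi; have [df dE] := Cn_on1_frechet (vel_frame N) oD (sf 1%N) Dxi.
by rewrite /total_derivative deriveE// dE.
Qed.

Lemma smooth_vshift_entry (p : 'I_N.+1 * 'I_n.+1) :
  smooth_on D (fun xi : V => vshift xi p.1 p.2).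
Proof.
case: (ltnP p.1 N) => pN.
  by apply: (smooth_ext oD) (smooth_vel_coord p.1.+1 p.2 oD) => x _; rewrite mxE pN.
by apply: (smooth_ext oD) (smooth_cst D 0) => x _; rewrite mxE ltnNge pN.
Qed.

Lemma smooth_tot f : smooth_on D f -> smooth_on D (tot f).
Proof.
move=> sf; apply: (smooth_ext oD (f := fun xi => \sum_(p : 'I_N.+1 * 'I_n.+1)
    vshift xi p.1 p.2 * 'D_(delta_mx p.1 p.2) f xi)).
  by move=> x Dx; rewrite totE.
apply: (smooth_bigsum oD) => p; apply: (smoothM (vel_frame N) oD).
  exact: smooth_vshift_entry.
exact: smooth_derive.
Qed.

Lemma tot_ext f g : (forall x, D x -> f x = g x) -> forall x, D x -> tot f x = tot g x.
Proof.
move=> fg x Dx; apply: near_eq_derive.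
by apply: filterS (open_nbhs_nbhs (conj oD Dx)) => y; exact: fg.
Qed.

Lemma totD f g : smooth_on D f -> smooth_on D g ->
  forall x, D x -> tot (fun x => f x + g x) x = tot f x + tot g x.
Proof.
by move=> sf sg x Dx; rewrite /total_derivative deriveD//; exact: smooth_derivable Dx.
Qed.

Lemma totM f g : smooth_on D f -> smooth_on D g ->
  forall x, D x -> tot (fun x => f x * g x) x = tot f x * g x + f x * tot g x.
Proof.
move=> sf sg x Dx; rewrite /total_derivative deriveM; [|exact: smooth_derivable Dx..].
by rewrite addrC /GRing.scale /=; ring.
Qed.

Lemma tot_cst (c : R) x : tot (fun=> c) x = 0.
Proof. exact: derive_cst. Qed.

Lemma totZ (c : R) f : smooth_on D f ->
  forall x, D x -> tot (fun x => c * f x) x = c * tot f x.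
Proof.
move=> sf x Dx; rewrite (totM (smooth_cst D c) sf)// tot_cst mul0r add0r //.
Qed.

Lemma tot_vel_coord q a x : (q < N)%N ->
  tot (fun xi => vel_coord xi q a) x = vel_coord x q.+1 a.
Proof.
move=> qN; rewrite /total_derivative.
by rewrite (derive_val (is_derive := is_derive_vel_coord _ _ _ _)) vel_coord_vshift.
Qed.

(** The vector field [vshift] is linear, so its derivative in the direction [v] is
    [vshift v]; the other term comes from the symmetry of second derivatives. On
    basis vectors this is the commutation rule of d/dzeta with the partial
    derivative in x^a_(m), which yields the partial derivative in x^a_(m-1). *)
Lemma derive_tot f xi v : smooth_on D f -> D xi ->
  'D_v (tot f) xi = tot ('D_v f) xi + 'D_(vshift v) f xi.
Proof.
move=> sf Dxi.
pose F (p : 'I_N.+1 * 'I_n.+1) (xi : V) := vshift xi p.1 p.2 * 'D_(delta_mx p.1 p.2) f xi.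
have sF p : smooth_on D (F p).
  apply: (smoothM (vel_frame N) oD); first exact: smooth_vshift_entry.
  exact: smooth_derive.
rewrite (near_eq_derive (g := fun xi => \sum_p F p xi)); last first.
  by apply: filterS (open_nbhs_nbhs (conj oD Dxi)) => y; exact: totE.
have dF p : is_derive xi v (F p) (vshift xi p.1 p.2 * 'D_(delta_mx p.1 p.2) ('D_v f) xi
    + vshift v p.1 p.2 * 'D_(delta_mx p.1 p.2) f xi).
  apply: is_derive_eq.
    apply: is_deriveM; first exact: is_derive_vshift_entry.
    by apply: derivableP; apply: (smooth_derivable _ Dxi); exact: smooth_derive.
  by rewrite (smooth_schwarz oD v _ sf Dxi) /GRing.scale /=; ring.
have [_ ->] := is_derive_bigsum (index_enum _) dF.
rewrite big_split /= -totE//; last exact: smooth_derive.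
have [df dE] := Cn_on1_frechet (vel_frame N) oD (sf 1%N) Dxi.
by rewrite (deriveE (vshift v))// dE.
Qed.

End TotalDerivative.

(** * Formal adjoints of differential operators in the parameter *)

Section Adjoint.
Context {R : realType} {n N : nat}.
Local Notation V := (velocities R N n).
Implicit Types (f g : V -> R) (a b : nat -> V -> R) (xi v x : V).
Variable D : set V.
Hypothesis oD : open D.
Local Notation smooth := (smooth_on D).
Local Notation tot := (@total_derivative R n N).

Lemma iter_tot_ext m f g : (forall x, D x -> f x = g x) ->
  forall x, D x -> iter m tot f x = iter m tot g x.
Proof. by move=> fg; elim: m => //= m IH x Dx; exact: (tot_ext oD). Qed.

Lemma smooth_iter_tot m f : smooth f -> smooth (iter m tot f).
Proof. by move=> sf; elim: m => //= m IH; exact: smooth_tot. Qed.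

Lemma iter_totD m f g : smooth f -> smooth g -> forall x, D x ->
  iter m tot (fun y => f y + g y) x = iter m tot f x + iter m tot g x.
Proof.
move=> sf sg; elim: m => //= m IH x Dx.
by rewrite (tot_ext oD IH Dx) (totD (D := D))//; exact: smooth_iter_tot.
Qed.

Lemma iter_tot0 m f : (forall x, D x -> f x = 0) -> forall x, D x -> iter m tot f x = 0.
Proof.
move=> f0 x Dx; rewrite (iter_tot_ext m f0 Dx).
elim: m x Dx => //= m IH x Dx; rewrite (tot_ext oD IH Dx); exact: tot_cst.
Qed.

(** The value at [g] of the formal adjoint of the operator sum_m a_m D^m, where D
    is the total derivative. At [g = 1], with [a m] the partial derivatives of a
    Lagrange function in x^a_(m), it is the Euler-Poisson expression. *)
Definition formal_adj (k : nat) a g xi : R :=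
  \sum_(m < k.+1) (-1) ^+ m * iter m tot (fun y => a m y * g y) xi.

Variable k : nat.

Lemma adj_ext a b f g : (forall m x, (m <= k)%N -> D x -> a m x * f x = b m x * g x) ->
  forall x, D x -> formal_adj k a f x = formal_adj k b g x.
Proof.
move=> E x Dx; apply: eq_bigr => m _; congr (_ * _).
by apply: iter_tot_ext => // y Dy; apply: E; rewrite // -ltnS.
Qed.

Lemma adjD a b g : (forall m, smooth (a m)) -> (forall m, smooth (b m)) -> smooth g ->
  forall x, D x -> formal_adj k (fun m y => a m y + b m y) g x =
    formal_adj k a g x + formal_adj k b g x.
Proof.
move=> sa sb sg x Dx; rewrite /formal_adj -big_split; apply: eq_bigr => m _ /=.
rewrite -mulrDr -iter_totD//; try exact: (smoothM (vel_frame N) oD).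
by congr (_ * _); apply: iter_tot_ext => // y _; rewrite mulrDl.
Qed.

Lemma adj_bigsum (I : Type) (s : seq I) (A : I -> nat -> V -> R) g :
  (forall i m, smooth (A i m)) -> smooth g -> forall x, D x ->
  formal_adj k (fun m y => \sum_(i <- s) A i m y) g x =
    \sum_(i <- s) formal_adj k (A i) g x.
Proof.
move=> sA sg x Dx; elim: s => [|i s IH].
  rewrite big_nil /formal_adj big1// => m _; rewrite iter_tot0 ?mulr0// => y _.
  by rewrite big_nil mul0r.
rewrite big_cons -IH -adjD//; last by move=> m; exact: smooth_bigsum.
by apply: adj_ext => // m y _ _; rewrite big_cons.
Qed.

Lemma adj_delta0 f g x : D x ->
  formal_adj k (fun m y => if m == 0%N then f y else 0) g x = f x * g x.
Proof.
move=> Dx; rewrite /formal_adj big_ord_recl /= expr0 mul1r big1 ?addr0// => m _.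
rewrite [X in _ * X](_ : _ = 0) ?mulr0//.
by apply: (@iter_tot0 m.+1) => // y _; rewrite mul0r.
Qed.

Lemma adj_delta1 f g x : (0 < k)%N -> D x ->
  formal_adj k (fun m y => if m == 1%N then f y else 0) g x = - tot (fun y => f y * g y) x.
Proof.
case: k => // k' _ Dx; rewrite /formal_adj 2!big_ord_recl /= big1 ?addr0.
  by rewrite mul0r mulr0 add0r expr1 mulN1r.
move=> m _; rewrite [X in _ * X](_ : _ = 0) ?mulr0//.
by apply: (@iter_tot0 m.+2) => // y _; rewrite mul0r.
Qed.

(** The sequence on the left is that of D composed with sum_m a_m D^m, so this
    is the rule (D A)^* = A^* (- D). The product rule turns the left side into
    the right side plus a telescoping sum, whose last term vanishes because
    [a k] does. *)
Lemma adj_tot a g : (forall m, smooth (a m)) -> smooth g ->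
  (forall x, D x -> a k x = 0) -> forall x, D x ->
  formal_adj k (fun m y => tot (a m) y + (if m is m'.+1 then a m' y else 0)) g x =
  formal_adj k a (fun y => - tot g y) x.
Proof.
move=> sa sg ak x Dx.
(* The terms [X m] and [X m.-1] of the expanded sum cancel in pairs. *)
pose X m := iter m.+1 tot (fun y => a m y * g y) x.
have sNg : smooth (fun y => - tot g y).
  by apply: (smoothN (vel_frame N) oD); exact: smooth_tot.
have smul := smoothM (vel_frame N) oD.
rewrite /formal_adj.
have E m : iter m tot (fun y => (tot (a m) y + (if m is m'.+1 then a m' y else 0)) * g y) x
  = X m + (if m is m'.+1 then X m' else 0) + iter m tot (fun y => a m y * - tot g y) x.
  transitivity (iter m tot (fun y => (tot (fun y => a m y * g y) y +
     (if m is m'.+1 then a m' y * g y else 0)) + a m y * - tot g y) x).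
    apply: iter_tot_ext => // y Dy; rewrite (totM (D := D))//.
    by case: (m) => [|m']; ring.
  have s1 : smooth (tot (fun y => a m y * g y)) by apply: smooth_tot => //; exact: smul.
  have s2 : smooth (fun y => if m is m'.+1 then a m' y * g y else 0).
    by case: (m) => [|m']; [exact: smooth_cst|exact: smul].
  rewrite !iter_totD//; [|exact: (smoothD oD)|exact: smul].
  congr (_ + _ + _); first by rewrite /X iterSr.
  by case: (m).
rewrite (eq_bigr (fun m : 'I_k.+1 => (-1) ^+ m * X m +
   (-1) ^+ m * (if (m : nat) is m'.+1 then X m' else 0) +
   (-1) ^+ m * iter m tot (fun y => a m y * - tot g y) x)); last first.
  by move=> m _; rewrite E !mulrDr.
rewrite !big_split /= [X in X + _ + _]big_ord_recr [X in _ + X + _]big_ord_recl /=.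
have -> : X k = 0.
  by rewrite /X iter_tot0// => y Dy; rewrite ak// mul0r.
rewrite !mulr0 addr0 add0r -[RHS]add0r; congr (_ + _).
rewrite -big_split big1// => m _ /=.
by rewrite exprS; ring.
Qed.

End Adjoint.

(** * Total derivatives on jets and on velocities compared *)

(** Transports locality and vanishing of increments to derivatives of functions
    of which no regularity is known. *)
Lemma derive_increment_eq {R : realType} {V W : normedModType R}
    (f : V -> R) (g : W -> R) x v y w :
  (forall h : R, f (h *: v + x) - f x = g (h *: w + y) - g y) ->
  'D_v f x = 'D_w g y.
Proof.
move=> E; rewrite /derive (_ : (fun h : R => _) =
  (fun h : R => h^-1 *: ((g \o shift y) (h *: w) - g y)))//.
by apply/funext => h /=; rewrite E.
Qed.

Section Truncations.
Context {R : realType} {n : nat} (U : set 'rV[R]_n).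
Hypothesis oU : open U.

Lemma vel_trunc_linear r r' : linear (@vel_trunc R n r r').
Proof. by move=> c x y; apply/matrixP => q a; rewrite !mxE. Qed.

Lemma vel_trunc_continuous r r' : continuous (@vel_trunc R n r r').
Proof.
move=> xi; apply: (frame_continuous (C := vel_frame r')) => -[q a].
rewrite (_ : _ \o _ = fun xi : velocities R r n => vel_coord xi q a).
  exact: vel_coord_continuous.
by apply/funext => y /=; rewrite /mx_entry mxE.
Qed.

Lemma jet_trunc_linear r r' : linear (@jet_trunc R n r r').
Proof. by move=> c x y; congr (_, _); apply/matrixP => q a; rewrite !mxE. Qed.

Lemma jet_trunc_continuous r r' : continuous (@jet_trunc R n r r').
Proof.
move=> xi; apply: (frame_continuous (C := jet_frame r')) => -[[q a]|].
  rewrite (_ : _ \o _ = fcoord (jet_frame r) (Some (inord q, a))); first exact: fcoord_cont.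
  by apply/funext => y /=; rewrite mxE.
rewrite (_ : _ \o _ = fcoord (jet_frame r) None); first exact: fcoord_cont.
by apply/funext.
Qed.

Lemma vel_coord_trunc r r' (xi : velocities R r n) q a : (q <= r')%N ->
  vel_coord (vel_trunc r' xi) q a = vel_coord xi q a.
Proof. by move=> qr; rewrite /vel_coord mxE inordK. Qed.

Lemma vel_trunc_dom r r' (xi : velocities R r n) : (0 < r')%N ->
  vel_dom U xi -> vel_dom U (vel_trunc r' xi).
Proof.
move=> r0; rewrite /vel_dom /= /tdot vel_coord_trunc// => -[Ux tx]; split => //.
rewrite (_ : (\row_i _) = (\row_i vel_coord xi 0 (lift ord0 i)))//.
by apply/rowP => i; rewrite !mxE vel_coord_trunc.
Qed.

Lemma jet_trunc_dom r r' (j : jets R r n) : jet_dom U j -> jet_dom U (jet_trunc r' j).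
Proof.
rewrite /jet_dom /= (_ : row ord0 (\matrix_(q, i) _) = row ord0 j.2)//.
apply/rowP => i; rewrite !mxE; congr (j.2 _ _).
by apply/val_inj; rewrite /= inordK.
Qed.

Lemma vel_truncK r r' r'' (xi : velocities R r n) : (r'' <= r')%N ->
  vel_trunc r'' (vel_trunc r' xi) = vel_trunc r'' xi.
Proof.
move=> rr; apply/matrixP => q a; rewrite !mxE inordK//.
by rewrite ltnS (leq_trans _ rr)// -ltnS.
Qed.

Lemma smooth_d_dt r (f : jets R r n -> R) :
  smooth_on (jet_dom U) f -> smooth_on (jet_dom U) (d_dt f).
Proof.
move=> sf; have oJ r' := @jet_dom_open R n r' U oU.
have st v : smooth_on (@jet_dom R n r.+1 U) ('D_v f \o jet_trunc r).
  apply: (smooth_linear_precomp (@jet_trunc_linear _ _) (@jet_trunc_continuous _ _)).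
    by move=> j; exact: jet_trunc_dom.
  exact: smooth_derive.
apply: (smoothD (oJ _)); first exact: st.
apply: (smooth_bigsum (oJ _)) => q; apply: (smooth_bigsum (oJ _)) => i.
apply: (smoothM (jet_frame _) (oJ _)); last exact: st.
apply: (@smooth_linear _ _ _ (oJ _) (fcoord (jet_frame r.+1) (Some (lift ord0 q, i)))).
exact: fcoord_cont.
Qed.

Lemma smooth_d_dzeta r (f : velocities R r n -> R) : (0 < r)%N ->
  smooth_on (vel_dom U) f -> smooth_on (vel_dom U) (d_dzeta f).
Proof.
move=> r0 sf; have oV r' := @vel_dom_open R n r' U oU.
have st v : smooth_on (@vel_dom R n r.+1 U) ('D_v f \o vel_trunc r).
  apply: (smooth_linear_precomp (@vel_trunc_linear _ _) (@vel_trunc_continuous _ _)).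
    by move=> j; exact: vel_trunc_dom.
  exact: smooth_derive.
apply: (smooth_bigsum (oV _)) => q; apply: (smooth_bigsum (oV _)) => i.
apply: (smoothM (vel_frame _) (oV _)); last exact: st.
apply: (@smooth_linear _ _ _ (oV _) (mx_entry (lift ord0 q) i)).
exact: coord_continuous.
Qed.

Lemma d_dzetaE r (f : velocities R r n -> R) (xi : velocities R r.+1 n) : (0 < r)%N ->
  smooth_on (vel_dom U) f -> vel_dom U xi ->
  d_dzeta f xi =
    'D_(\matrix_(q, a) (xi : 'M[R]_(_, _)) (lift ord0 q) a : velocities R r n) f
      (vel_trunc r xi).
Proof.
move=> r0 sf Dxi.
have [df dE] :=
  Cn_on1_frechet (vel_frame r) (vel_dom_open oU) (sf 1%N) (vel_trunc_dom r0 Dxi).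
rewrite deriveE// dE /d_dzeta pair_bigA; apply: eq_bigr => -[q a] _ /=.
by rewrite /mx_entry mxE.
Qed.

Lemma d_dtE r (f : jets R r n -> R) (j : jets R r.+1 n) :
  d_dt f j = \sum_x fcoord (jet_frame r) x (1, \matrix_(q, i) j.2 (lift ord0 q) i)
     * 'D_(fbasis (jet_frame r) x) f (jet_trunc r j).
Proof.
rewrite big_option /= mul1r; congr (_ + _).
by rewrite pair_bigA; apply: eq_bigr => -[q i] _ /=; rewrite mxE.
Qed.

Lemma smooth_d_dt_iter m r (f : jets R r n -> R) :
  smooth_on (jet_dom U) f -> smooth_on (jet_dom U) (@d_dt_iter R n m r f).
Proof. by move=> sf; elim: m => //= m IH; exact: smooth_d_dt. Qed.

Lemma smooth_d_dzeta_iter m r (f : velocities R r n -> R) : (0 < r)%N ->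
  smooth_on (vel_dom U) f -> smooth_on (vel_dom U) (@d_dzeta_iter R n m r f).
Proof.
move=> r0 sf; elim: m => //= m IH; apply: smooth_d_dzeta => //.
by rewrite addn_gt0 r0 orbT.
Qed.

End Truncations.

Section Prolongation.
Context {R : realType} {n N : nat} (U : set 'rV[R]_n).
Hypotheses (oU : open U) (N0 : (0 < N)%N).
Local Notation V := (velocities R N n).
Local Notation D := (@vel_dom R n N U).
Local Notation smooth := (smooth_on D).
Local Notation tot := (@total_derivative R n N).
Implicit Types (xi x v : V).

Let oD : open D := vel_dom_open oU.

Lemma tot_d_dzeta r (f : velocities R r n -> R) xi : (0 < r < N)%N ->
  smooth_on (vel_dom U) f -> D xi ->
  d_dzeta f (vel_trunc r.+1 xi) = tot (f \o vel_trunc r) xi.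
Proof.
case/andP => r0 rN sf Dxi.
rewrite (d_dzetaE oU)//; last exact: vel_trunc_dom.
rewrite (vel_truncK xi (leqnSn r)) /total_derivative.
rewrite derive_linear_precomp; last exact: vel_trunc_linear.
congr ('D_ _ f _); apply/matrixP => q a.
have qN : (q < N)%N by rewrite (leq_ltn_trans _ rN)// -ltnS.
by rewrite !mxE inordK ?qN ?ltnS ?(ltnW qN)// /vel_coord lift0.
Qed.

Lemma iter_tot_d_dzeta m r (f : velocities R r n -> R) xi : (0 < r)%N -> (m + r <= N)%N ->
  smooth_on (vel_dom U) f -> D xi ->
  @d_dzeta_iter R n m r f (vel_trunc (m + r) xi) = iter m tot (f \o vel_trunc r) xi.
Proof.
move=> r0 mrN sf; elim: m mrN xi => [|m IH] mrN xi Dxi //=.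
rewrite tot_d_dzeta//; first last.
- exact: smooth_d_dzeta_iter.
- by rewrite addn_gt0 r0 orbT.
by apply: (tot_ext oD) => // y Dy; apply: IH => //; exact: ltnW.
Qed.

Lemma tdotE xi : tdot xi = vel_coord xi 1 ord0.
Proof. by []. Qed.

Lemma tdot_neq0 xi : D xi -> tdot xi != 0.
Proof. by case. Qed.

Lemma smooth_tdot : smooth (fun xi => tdot xi).
Proof. exact: smooth_vel_coord. Qed.

Lemma smooth_div_tdot f : smooth f -> smooth (fun xi => f xi / tdot xi).
Proof.
move=> sf; apply: (smoothM (vel_frame N) oD) => //.
by apply: (smoothV (vel_frame N) oD); [exact: tdot_neq0|exact: smooth_tdot].
Qed.

(** The coordinate v_(q-1) of the projected jet, as a function of velocities. It
    comes from v_(q) dt/dzeta = d v_(q-1) / dzeta rather than from closed formulas. *)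
Fixpoint jet_entry (q : nat) (i : 'I_n) : V -> R :=
  match q with
  | 0%N => fun xi => vel_coord xi 0 (lift ord0 i)
  | q'.+1 => fun xi => tot (jet_entry q' i) xi / tdot xi
  end.

Definition to_jet (r : nat) (xi : V) : jets R r n :=
  (vel_coord xi 0 ord0, \matrix_(q, i) jet_entry q i xi).

Lemma smooth_jet_entry q i : smooth (jet_entry q i).
Proof.
elim: q => [|q IH] /=; first exact: smooth_vel_coord.
by apply: smooth_div_tdot; exact: smooth_tot.
Qed.

Lemma tot_jet_entry q i x : D x -> tot (jet_entry q i) x = tdot x * jet_entry q.+1 i x.
Proof. by move=> Dx /=; rewrite mulrC divfK//; exact: tdot_neq0. Qed.

Lemma to_jet_dom r xi : D xi -> jet_dom U (to_jet r xi).
Proof.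
case=> Ux _; rewrite /jet_dom /= (_ : row _ _ = \row_i vel_coord xi 0 (lift ord0 i))//.
by apply/rowP => i; rewrite !mxE.
Qed.

Lemma jet_trunc_to_jet r r' xi : (r' <= r)%N -> jet_trunc r' (to_jet r xi) = to_jet r' xi.
Proof.
move=> rr; congr (_, _); apply/matrixP => q i; rewrite !mxE inordK//.
by rewrite ltnS (leq_trans _ rr)// -ltnS.
Qed.

Lemma fcoord_to_jet r p : fcoord (jet_frame r) p \o to_jet r =
  if p is Some (q, i) then jet_entry q i else (fun xi => vel_coord xi 0 ord0).
Proof. by case: p => [[q i]|]; apply/funext => x //=; rewrite mxE. Qed.

Lemma smooth_fcoord_to_jet r p : smooth (fcoord (jet_frame r) p \o to_jet r).
Proof.
rewrite fcoord_to_jet; case: p => [[q i]|]; first exact: smooth_jet_entry.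
exact: smooth_vel_coord.
Qed.

Lemma smooth_to_jet r (f : jets R r n -> R) :
  smooth_on (jet_dom U) f -> smooth (f \o to_jet r).
Proof.
apply: (smooth_comp (vel_frame N) (C := jet_frame r)) => //.
- exact: jet_dom_open.
- exact: to_jet_dom.
- exact: smooth_fcoord_to_jet.
Qed.

Lemma is_derive_to_jet r (f : jets R r n -> R) x v :
  smooth_on (jet_dom U) f -> D x ->
  is_derive x v (f \o to_jet r)
   (\sum_p 'D_v (fcoord (jet_frame r) p \o to_jet r) x *
      'D_(fbasis (jet_frame r) p) f (to_jet r x)).
Proof.
move=> sf Dx; apply: is_derive_frame_comp.
  by apply: (smooth_differentiable (jet_frame r) (jet_dom_open oU) sf); exact: to_jet_dom.
by move=> p; exact: smooth_derivable (smooth_fcoord_to_jet p) Dx.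
Qed.

(** Chain rule: the total derivatives of the coordinates of the projected jet are
    [tdot] times the coordinates one order higher. *)
Lemma tot_to_jet r (f : jets R r n -> R) x :
  smooth_on (jet_dom U) f -> D x ->
  tot (f \o to_jet r) x = tdot x * d_dt f (to_jet r.+1 x).
Proof.
move=> sf Dx; rewrite d_dtE.
have [_ Ed] := is_derive_to_jet (vshift x) sf Dx.
rewrite [LHS]Ed mulr_sumr.
apply: eq_bigr => -[[q i]|] _; rewrite mulrA jet_trunc_to_jet//; congr (_ * _);
  rewrite fcoord_to_jet -[LHS]/(tot _ x) /=.
  by rewrite !mxE lift0 tot_jet_entry.
by rewrite tot_vel_coord// mulr1.
Qed.

(** The operator d/dt = (1 / tdot) d/dzeta, on functions of velocities. *)
Definition time_derivative (f : V -> R) (xi : V) : R := tot f xi / tdot xi.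

Lemma iter_time_derivative_d_dt m r (f : jets R r n -> R) x :
  smooth_on (jet_dom U) f -> D x ->
  @d_dt_iter R n m r f (to_jet (m + r) x) = iter m time_derivative (f \o to_jet r) x.
Proof.
move=> sf; elim: m x => [|m IH] x Dx //=.
rewrite /time_derivative -(tot_ext oD IH Dx) tot_to_jet//; last exact: smooth_d_dt_iter.
by rewrite mulrC mulKf//; exact: tdot_neq0.
Qed.

(** The recursion for the first variation of the jet coordinates; the last term
    is the variation of [1 / tdot]. *)
Lemma derive_jet_entryS q i x v : D x ->
  'D_v (jet_entry q.+1 i) x = (tot ('D_v (jet_entry q i)) x
     + 'D_(vshift v) (jet_entry q i) x - vel_coord v 1 ord0 * jet_entry q.+1 i x) / tdot x.
Proof.
move=> Dx; have t0 := tdot_neq0 Dx.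
have sw := smooth_jet_entry q i.
have dt : is_derive x v (fun x => tdot x) (vel_coord v 1 ord0).
  exact: is_derive_vel_coord.
have dtV : is_derive x v (fun x => (tdot x)^-1) (- (tdot x) ^- 2 *: vel_coord v 1 ord0).
  by split; [exact: derivableV|rewrite deriveV// (derive_val (is_derive := dt))].
have dT : is_derive x v (tot (jet_entry q i)) (tot ('D_v (jet_entry q i)) x
     + 'D_(vshift v) (jet_entry q i) x).
  split; last exact: (derive_tot oD).
  by apply: smooth_derivable Dx; exact: smooth_tot.
have [_ E] := is_deriveM dT dtV.
rewrite [LHS]E /= /GRing.scale /=; field.
exact: t0.
Qed.

(** This makes the jet of order [r] a function of the velocity of order [r],
    although [jet_entry] is defined on velocities of order [N]. *)
Lemma jet_entry_local q i x y : (q <= N)%N ->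
  (forall p a, (p <= q)%N -> vel_coord x p a = vel_coord y p a) ->
  jet_entry q i x = jet_entry q i y.
Proof.
elim: q x y => [|q IH] x y qN xy /=; first exact: xy.
congr (_ / _); last exact: xy.
apply: derive_increment_eq => h.
have xy' p a : (p <= q)%N -> vel_coord x p a = vel_coord y p a.
  by move=> pq; apply: xy; exact: leqW.
congr (_ - _); apply: (IH _ _ (ltnW qN)) => p a pq; last exact: xy'.
rewrite !vel_coord_linear !vel_coord_vshift ?(leq_ltn_trans pq)// xy//.
by rewrite xy'.
Qed.

Lemma derive_jet_entry_top q i x v : (q <= N)%N ->
  (forall p a, (p <= q)%N -> vel_coord v p a = 0) -> 'D_v (jet_entry q i) x = 0.
Proof.
move=> qN v0; rewrite -(derive0 (jet_entry q i) x); apply: derive_increment_eq => h.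
congr (_ - _).
apply: jet_entry_local => // p a pq.
by rewrite scaler0 add0r vel_coord_linear v0// [_ *: _]mulr0 add0r.
Qed.

End Prolongation.

(** * Variations of the jet coordinates *)

Section EulerOperators.
Context {R : realType} {n N : nat} (U : set 'rV[R]_n).
Hypotheses (oU : open U) (N0 : (0 < N)%N).
Local Notation V := (velocities R N n).
Local Notation D := (@vel_dom R n N U).
Local Notation smooth := (smooth_on D).
Local Notation tot := (@total_derivative R n N).
Local Notation jet_entry := (@jet_entry R n N).
Local Notation to_jet := (@to_jet R n N).
Implicit Types (f g : V -> R) (xi x v : V).

Let oD : open D := vel_dom_open oU.

Definition vel_basis (m : nat) (a : 'I_n.+1) : V := delta_mx (inord m) a.

Lemma vel_coord_basis m a q b : (m <= N)%N -> (q <= N)%N ->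
  vel_coord (vel_basis m a) q b = ((m == q) && (a == b))%:R.
Proof.
move=> mN qN; rewrite /vel_coord mxE -val_eqE /= !inordK// (eq_sym q) (eq_sym b).
by [].
Qed.

Lemma vshift_basis0 a : vshift (vel_basis 0 a) = 0.
Proof.
apply/matrixP => q b; rewrite !mxE; case: ifP => // qN.
by rewrite vel_coord_basis.
Qed.

Lemma vshift_basisS m a : (m < N)%N -> vshift (vel_basis m.+1 a) = vel_basis m a.
Proof.
move=> mN; apply/matrixP => q b.
rewrite !mxE -val_eqE /= (inordK (leq_trans mN (leqnSn N))).
case: (ltnP q N) => [qN|Nq].
  by rewrite vel_coord_basis// eqSS (eq_sym m) (eq_sym a).
by rewrite (gtn_eqF (leq_trans mN Nq)).
Qed.

(** The formal adjoint of (1 / tdot) d/dzeta, namely g |-> - d/dzeta (g / tdot). *)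
Definition time_derivative_adj (g : V -> R) (x : V) : R := - tot (fun y => g y / tdot y) x.

Lemma smooth_time_derivative_adj g : smooth g -> smooth (time_derivative_adj g).
Proof.
move=> sg; apply: (smoothN (vel_frame N) oD); apply: (smooth_tot oD).
exact: smooth_div_tdot.
Qed.

Lemma smooth_time_derivative g : smooth g -> smooth (time_derivative g).
Proof. by move=> sg; apply: smooth_div_tdot => //; exact: (smooth_tot oD). Qed.

Lemma smooth_iter_time_derivative q g : smooth g -> smooth (iter q time_derivative g).
Proof. by move=> sg; elim: q => //= q; exact: smooth_time_derivative. Qed.

Lemma time_derivative_adj_ext f g : (forall x, D x -> f x = g x) ->
  forall x, D x -> time_derivative_adj f x = time_derivative_adj g x.
Proof.
move=> fg x Dx; rewrite /time_derivative_adj; congr (- _).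
by apply: (tot_ext oD) => // y Dy; rewrite fg.
Qed.

(** Conjugation by [tdot] turns - d/dzeta (1 / tdot) into - (1 / tdot) d/dzeta. *)
Lemma iter_time_derivative_adj q g : smooth g -> forall x, D x ->
  iter q time_derivative_adj (fun y => tdot y * g y) x =
    (-1) ^+ q * tdot x * iter q time_derivative g x.
Proof.
move=> sg; elim: q => [|q IH] x Dx /=; first by rewrite mul1r.
rewrite (time_derivative_adj_ext IH Dx) /time_derivative_adj.
rewrite (tot_ext oD 
  (g := fun y => (-1) ^+ q * iter q time_derivative g y))//.
  rewrite (totZ (D := D))//; last exact: smooth_iter_time_derivative.
  rewrite -/(time_derivative (iter q time_derivative g) x) {2}/time_derivative exprS.
  field; exact: tdot_neq0 Dx.
by move=> y Dy; field; exact: tdot_neq0 Dy.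
Qed.

Variable k : nat.
Hypotheses (k0 : (0 < k)%N) (kN : (k < N)%N).

Local Notation pd a q j := (fun m => 'D_(vel_basis m a) (jet_entry q j)).

Lemma smooth_pd a q j m : smooth (pd a q j m).
Proof. by apply: smooth_derive; exact: smooth_jet_entry. Qed.

Lemma adj_jet_entry0 a j g x : D x ->
  formal_adj k (pd a 0 j) g x = (a == lift ord0 j)%:R * g x.
Proof.
move=> Dx; rewrite -(@adj_delta0 _ _ _ D oD k (fun=> (a == lift ord0 j)%:R))//.
apply: (adj_ext oD) => // m y mk Dy; congr (_ * _).
rewrite [LHS](derive_val (is_derive := is_derive_vel_coord _ _ _ _)).
rewrite vel_coord_basis// ?(leq_trans mk (ltnW kN))//.
by case: eqP.
Qed.

(** The variation of v_(q) is (1 / tdot) D applied to that of v_(q-1), up to the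
    variation of [tdot] itself; [adj_tot] moves D to the test function. *)
Lemma adj_jet_entryS a q j g x : (q < k)%N -> smooth g -> D x ->
  formal_adj k (pd a q.+1 j) g x = formal_adj k (pd a q j) (time_derivative_adj g) x
    + (a == ord0)%:R * tot (fun y => jet_entry q.+1 j y * (g y / tdot y)) x.
Proof.
move=> qk sg Dx.
have sgt := smooth_div_tdot oU sg.
have qN : (q <= N)%N by exact: ltnW (ltn_trans qk kN).
have sJ := smooth_jet_entry (N := N) oU.
have pdk y : D y -> pd a q j k y = 0.
  move=> _; apply: derive_jet_entry_top => // p b pq.
  by rewrite vel_coord_basis ?(ltnW kN) ?(leq_trans pq)// gtn_eqF// (leq_ltn_trans pq).
pose b1 m y := tot (pd a q j m) y + (if m is m'.+1 then pd a q j m' y else 0).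
pose b2 m (y : V) := if m == 1%N then (- (a == ord0)%:R) * jet_entry q.+1 j y else 0.
transitivity (formal_adj k (fun m y => b1 m y + b2 m y) (fun y => g y / tdot y) x).
  apply: (adj_ext oD) => // m y mk Dy.
  have mN : (m <= N)%N by exact: leq_trans mk (ltnW kN).
  rewrite (derive_jet_entryS oU)// vel_coord_basis//.
  rewrite [RHS]mulrA [in RHS]mulrAC; congr (_ / _ * _).
  rewrite /b1 /b2; case: m mk mN => [|m] mk mN.
    by rewrite vshift_basis0 derive0 mul0r subr0 !addr0.
  rewrite vshift_basisS//; case: eqP => _ /=; last by rewrite mul0r subr0 addr0.
  by rewrite mulNr.
have sb1 m : smooth (b1 m).
  apply: (smoothD oD); first by apply: (smooth_tot oD); exact: smooth_pd.
  by case: m => [|m]; [exact: smooth_cst|exact: smooth_pd].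
have sb2 m : smooth (b2 m).
  rewrite /b2; case: eqP => _; last exact: smooth_cst.
  by apply: (smoothM (vel_frame N) oD); [exact: smooth_cst|exact: sJ].
rewrite (adjD oD k sb1 sb2 sgt Dx); congr (_ + _).
  by rewrite (adj_tot oD (smooth_pd a q j) sgt pdk Dx).
rewrite (adj_delta1 oD)//.
rewrite (tot_ext oD
  (g := fun y => - (a == ord0)%:R * (jet_entry q.+1 j y * (g y / tdot y))))//.
  rewrite (totZ (D := D))//; first by rewrite mulNr opprK.
  by apply: (smoothM (vel_frame N) oD) => //; exact: sJ.
by move=> y _; rewrite [RHS]mulrA.
Qed.

(** For a variation eta of x^i at fixed t, the variation of v_(q-1) is
    ((1 / tdot) D)^q eta, and this is its adjoint. *)
Lemma adj_jet_entry_space i q j g x : (q <= k)%N -> smooth g -> D x ->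
  formal_adj k (pd (lift ord0 i) q j) g x = (i == j)%:R * iter q time_derivative_adj g x.
Proof.
elim: q g => [|q IH] g qk sg Dx.
  by rewrite adj_jet_entry0// (inj_eq lift_inj).
rewrite adj_jet_entryS// IH// ?mul0r ?addr0 ?iterSr//; first exact: ltnW.
exact: smooth_time_derivative_adj.
Qed.

(** For a variation eta of t at fixed x, the variation of v_(q-1) is
    v_(q) eta - ((1 / tdot) D)^q (v eta), and this is its adjoint. *)
Lemma adj_jet_entry_time q j g x : (q <= k)%N -> smooth g -> D x ->
  formal_adj k (pd ord0 q j) g x =
    jet_entry q.+1 j x * g x - jet_entry 1 j x * iter q time_derivative_adj g x.
Proof.
elim: q g => [|q IH] g qk sg Dx.
  by rewrite adj_jet_entry0//= mul0r subrr.
rewrite adj_jet_entryS// IH//; [|exact: ltnW|exact: smooth_time_derivative_adj].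
rewrite eqxx mul1r iterSr (totM (D := D))//; last first.
- exact: smooth_div_tdot.
- exact: smooth_jet_entry.
rewrite (tot_jet_entry _ _ Dx) /time_derivative_adj.
have t0 := tdot_neq0 Dx.
set Tg := tot (fun y => g y / tdot y) x.
set w2 := jet_entry q.+2 j x; set w1 := jet_entry q.+1 j x.
by field.
Qed.

End EulerOperators.

(** * Variation of the lifted Lagrangian *)

Section Reparametrization.
Context {R : realType} {n N k : nat} (U : set 'rV[R]_n) (L : jets R k n -> R).
Hypotheses (oU : open U) (k0 : (0 < k)%N) (kN : (k < N)%N).
Hypothesis sL : smooth_on (jet_dom U) L.
Local Notation V := (velocities R N n).
Local Notation D := (@vel_dom R n N U).
Local Notation smooth := (smooth_on D).
Local Notation tot := (@total_derivative R n N).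
Local Notation jet_entry := (@jet_entry R n N).
Local Notation vel_basis := (@vel_basis R n N).
Local Notation to_jet := (@to_jet R n N).
Implicit Types (f g : V -> R) (xi x v : V).

Let oD : open D := vel_dom_open oU.
Let N0 : (0 < N)%N := ltn_trans k0 kN.

Definition lifted_lagrangian (x : V) : R := L (to_jet k x) * tdot x.

(** The partial derivatives of [L] in the coordinate [p] of the jet space ([None]
    is t and [Some (q, i)] is v^i_(q-1)), read on velocities. *)
Definition momentum (p : frame_index (jet_frame k)) (x : V) : R :=
  'D_(fbasis (jet_frame k) p) L (to_jet k x).

(** The Euler-Poisson expression of [L], read on velocities. *)
Definition spatial_euler (i : 'I_n) (x : V) : R :=
  \sum_(q < k.+1) (-1) ^+ q * iter q time_derivative (momentum (Some (q, i))) x.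

Lemma smooth_momentum p : smooth (momentum p).
Proof. exact: (smooth_to_jet oU (smooth_derive (fbasis (jet_frame k) p) sL)). Qed.

Lemma spatial_eulerE i x : (2 * k <= N)%N -> D x ->
  spatial_euler i x = euler_jet L i (to_jet (2 * k) x).
Proof.
move=> kkN Dx; apply: eq_bigr => q _; congr (_ * _).
rewrite jet_trunc_to_jet; last by rewrite mul2n -addnn leq_add2r -ltnS.
by rewrite (iter_time_derivative_d_dt oU N0 _ (smooth_derive _ sL)).
Qed.

Lemma derive_lifted_lagrangian v x : D x ->
  'D_v lifted_lagrangian x =
    \sum_p 'D_v (fcoord (jet_frame k) p \o to_jet k) x * (tdot x * momentum p x)
    + vel_coord v 1 ord0 * L (to_jet k x).
Proof.
move=> Dx.
have dt : is_derive x v (fun x => tdot x) (vel_coord v 1 ord0).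
  exact: is_derive_vel_coord.
have [_ E] := is_deriveM (is_derive_to_jet oU v sL Dx) dt.
rewrite [LHS]E /= addrC; congr (_ + _); last by rewrite [LHS]mulrC.
rewrite /GRing.scale /= mulr_sumr; apply: eq_bigr => p _.
by rewrite /momentum mulrCA.
Qed.

(** The first variation of [L tdot], with the adjoint taken term by term: [tdot]
    and t depend on no more than the time coordinate, and everything else enters
    through the jet coordinates. *)
Lemma adj_lifted_lagrangian a x : D x ->
  formal_adj k (fun m => 'D_(vel_basis m a) lifted_lagrangian) (fun=> 1) x =
    (a == ord0)%:R * (tdot x * momentum None x - tot (L \o to_jet k) x)
    + \sum_(q < k.+1) \sum_(j < n)
      formal_adj k (fun m => 'D_(vel_basis m a) (jet_entry q j))
        (fun y => tdot y * momentum (Some (q, j)) y) x.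
Proof.
move=> Dx; have sM := smoothM (vel_frame N) oD.
have st := smooth_tdot (N := N) oU.
pose A p m := 'D_(vel_basis m a) (fcoord (jet_frame k) p \o to_jet k).
have sA p m : smooth (A p m) by apply: smooth_derive; exact: smooth_fcoord_to_jet.
pose g p y := tdot y * momentum p y.
have sg p : smooth (g p) by apply: sM => //; exact: smooth_momentum.
pose b m (y : V) := if m == 1%N then (a == ord0)%:R * L (to_jet k y) else 0.
have sLJ : smooth (L \o to_jet k) by exact: smooth_to_jet.
have sb m : smooth (b m).
  rewrite /b; case: eqP => _; last exact: smooth_cst.
  by apply: sM => //; exact: smooth_cst.
transitivity (formal_adj k (fun m y => \sum_p A p m y * g p y + b m y) (fun=> 1) x).
  apply: (adj_ext oD) => // m y mk Dy; congr (_ * _).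
  rewrite derive_lifted_lagrangian// (vel_coord_basis _ _ (leq_trans mk (ltnW kN)) N0).
  by congr (_ + _); rewrite /b; case: (m == 1%N) => //=; rewrite mul0r.
have s1 : smooth (fun=> 1) by exact: smooth_cst.
have sAg p m : smooth (fun y => A p m y * g p y) by exact: sM.
rewrite (adjD oD)//; last by move=> m; exact: (smooth_bigsum oD).
rewrite (adj_bigsum oD k _ sAg)// (adj_delta1 oD)// big_option.
have -> : tot (fun y => (a == ord0)%:R * L (to_jet k y) * 1) x =
    (a == ord0)%:R * tot (L \o to_jet k) x.
  by rewrite -(totZ (D := D))//; congr (tot _ _); apply/funext => y; rewrite mulr1.
have EA p : formal_adj k (fun m y => A p m y * g p y) (fun=> 1) x =
    formal_adj k (A p) (g p) x.
  by apply: (adj_ext oD) => // m y _ _; rewrite mulr1.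
rewrite EA.
have -> : formal_adj k (A None) (g None) x = (a == ord0)%:R * g None x.
  rewrite -(@adj_delta0 _ _ _ D oD k (fun=> (a == ord0)%:R))//.
  apply: (adj_ext oD) => // m y mk Dy; congr (_ * _).
  rewrite /A fcoord_to_jet (derive_val (is_derive := is_derive_vel_coord _ _ _ _)).
  rewrite vel_coord_basis// ?(leq_trans mk (ltnW kN))//.
  by case: eqP.
rewrite addrAC -mulrBr; congr (_ + _).
rewrite [RHS]pair_bigA; apply: eq_bigr => -[q j] _ /=.
by rewrite EA /A fcoord_to_jet.
Qed.

Lemma euler_lifted_space i x : D x ->
  formal_adj k (fun m => 'D_(vel_basis m (lift ord0 i)) lifted_lagrangian) (fun=> 1) x =
    tdot x * spatial_euler i x.
Proof.
move=> Dx; rewrite adj_lifted_lagrangian//= mul0r add0r mulr_sumr.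
have sp p := smooth_momentum p.
apply: eq_bigr => q _; rewrite (bigD1 i)//= big1 ?addr0 => [|j ji].
  rewrite (adj_jet_entry_space oU)//; first last.
  - by apply: (smoothM (vel_frame N) oD) => //; exact: smooth_tdot.
  - by rewrite -ltnS.
  by rewrite eqxx mul1r (iter_time_derivative_adj oU)//; ring.
rewrite (adj_jet_entry_space oU)// ?(negbTE ji) 1?eq_sym ?(negbTE ji) ?mul0r//.
- by rewrite -ltnS.
- by apply: (smoothM (vel_frame N) oD) => //; exact: smooth_tdot.
Qed.

(** The terms with v_(q) and the partial derivative of [L] in t add up to the
    total derivative of [L], which cancels the one produced by the variation of
    [tdot]. What remains is the sum over i of - v^i times the spatial expressions. *)
Lemma euler_lifted_time x : D x ->
  formal_adj k (fun m => 'D_(vel_basis m ord0) lifted_lagrangian) (fun=> 1) x =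
    - \sum_(i < n) xdot x i * spatial_euler i x.
Proof.
move=> Dx; rewrite adj_lifted_lagrangian//= mul1r.
have sp p := smooth_momentum p; have t0 := tdot_neq0 Dx.
have -> : tot (L \o to_jet k) x = tdot x * momentum None x +
   \sum_(q < k.+1) \sum_(j < n) jet_entry q.+1 j x * (tdot x * momentum (Some (q, j)) x).
  have [_ E] := is_derive_to_jet oU (vshift x) sL Dx.
  rewrite [LHS]E big_option; congr (_ + _).
    by rewrite fcoord_to_jet -[X in X * _]/(tot _ x) tot_vel_coord.
  rewrite [RHS]pair_bigA; apply: eq_bigr => -[q j] _.
  rewrite fcoord_to_jet -[X in X * _]/(tot (jet_entry q j) x) (tot_jet_entry _ _ Dx).
  by rewrite [RHS]mulrCA [RHS]mulrA.
rewrite opprD addrA subrr add0r addrC -sumrB.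
rewrite (eq_bigr (fun q : 'I_k.+1 => - \sum_j jet_entry 1 j x * tdot x *
   ((-1) ^+ q * iter q time_derivative (momentum (Some (q, j))) x))); last first.
  move=> q _; rewrite -sumrB -sumrN; apply: eq_bigr => j _.
  rewrite (adj_jet_entry_time oU)//; first last.
  - by apply: (smoothM (vel_frame N) oD) => //; exact: smooth_tdot.
  - by rewrite -ltnS.
  by rewrite (iter_time_derivative_adj oU)//; ring.
rewrite sumrN exchange_big /=; congr (- _); apply: eq_bigr => j _.
rewrite -mulr_sumr /= divfK// tot_vel_coord//.
Qed.

End Reparametrization.

(** * The projection from velocities to jets *)

Section PolynomialCurves.
Context {R : realType}.

Lemma derive1n_horner (p : {poly R}) q : (horner p)^`(q) = horner p^`(q).
Proof. by elim: q => // q IH; rewrite derive1nS IH -derivE derivnS. Qed.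

Lemma derive1n_horner0 (p : {poly R}) q : (horner p)^`(q) 0 = p`_q *+ q`!.
Proof. by rewrite derive1n_horner horner_coef0 coef_derivn addn0 ffactnn. Qed.

(** The power z^q of the composite is affected by the coefficients up to q only,
    and by the last one through [s`_0 ^+ q]: a triangular system. *)
Lemma comp_poly_jet (s : {poly R}) (v : nat -> R) (r : nat) : s`_0 != 0 ->
  exists p : {poly R}, forall q, (q <= r)%N -> (p \Po ('X * s))`_q = v q.
Proof.
move=> s0; elim: r => [|r [p pP]].
  by exists (v 0%N)%:P => q; rewrite leqn0 => /eqP->; rewrite comp_polyC coefC.
(* ['X^(r.+1) contributes [s`_0 ^+ r.+1] to the coefficient of order [r.+1]. *)
pose c := (v r.+1 - (p \Po ('X * s))`_r.+1) / s`_0 ^+ r.+1.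
exists (p + c *: 'X^(r.+1)) => q; rewrite comp_polyD comp_polyZ comp_Xn_poly exprMn.
rewrite coefD coefZ coefXnM leq_eqVlt => /orP[/eqP->|qr].
  rewrite ltnn subnn -horner_coef0 horner_exp horner_coef0 /c divfK ?expf_neq0//.
  by rewrite addrC subrK.
by rewrite qr mulr0 addr0 pP.
Qed.

End PolynomialCurves.

Section Projection.
Context {R : realType} {n N : nat}.
Local Notation V := (velocities R N n).
Implicit Types (xi : V).

Lemma smooth_near_horner m (P : 'I_m -> {poly R}) (c : R -> 'rV[R]_m) z :
  (forall i, (fun s => c s ord0 i) = horner (P i)) -> smooth_near c z.
Proof.
move=> cP; near=> y; move=> p i; rewrite cP derive1n_horner.
exact: derivable_horner.
Unshelve. all: by end_near. Qed.

Lemma derive1n_vel_coord_poly (xi : V) a q : (q <= N)%N ->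
  (horner (\poly_(p < N.+1) (vel_coord xi p a / p`!%:R)))^`(q) 0 = vel_coord xi q a.
Proof.
move=> qN; rewrite derive1n_horner0 coef_poly ltnS qN /= -[X in X = _]mulr_natr divfK//.
Qed.

(** Both the curve and the graph can be taken polynomial: the time component is
    the Taylor polynomial of the velocity, and the space components are composites
    with it, so that no inverse of the time component is required. *)
Lemma represents_exists r xi : (0 < N)%N -> (r <= N)%N -> tdot xi != 0 ->
  exists j, represents (vel_trunc r xi) j.
Proof.
move=> N0 rN t0; pose x0 := vel_coord xi 0 ord0.
(* [tau - x0] is divisible by ['X], and [s] takes the value [tdot xi] at 0. *)
pose tau : {poly R} := \poly_(p < N.+1) (vel_coord xi p ord0 / p`!%:R).
pose s : {poly R} := \poly_(p < N) (vel_coord xi p.+1 ord0 / p.+1`!%:R).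
have tauE : tau = x0%:P + 'X * s.
  apply/polyP => q; rewrite coefD coefC coefXM !coef_poly.
  by case: q => [|q] /=; rewrite ?addr0 ?add0r ?fact0 ?divr1// ltnS.
have s0 : s`_0 != 0 by rewrite coef_poly N0 divr1.
have /choice[p pP] (i : 'I_n) : exists p : {poly R}, forall q, (q <= r)%N ->
    (p \Po ('X * s))`_q = vel_coord xi q (lift ord0 i) / q`!%:R.
  exact: comp_poly_jet.
pose P a := if unlift ord0 a is Some i then p i \Po ('X * s) else tau.
pose c z : 'rV[R]_n.+1 := \row_a (P a).[z].
pose X t : 'rV[R]_n := \row_i (p i \Po ('X - x0%:P)).[t].
have cP a : (fun z => c z ord0 a) = horner (P a) by apply/funext => z; rewrite mxE.
have c0 : time_part c = horner tau by rewrite /time_part cP /P unlift_none.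
have XP i : (fun t => X t ord0 i) = horner (p i \Po ('X - x0%:P)).
  by apply/funext => z; rewrite mxE.
exists (jet_of r X (time_part c 0)), c, X; split => //.
- split; first exact: smooth_near_horner cP.
  apply/matrixP => q a; rewrite !mxE cP.
  have qr : (q <= r)%N by rewrite -ltnS.
  rewrite -[RHS]/(vel_coord xi q a) derive1n_horner0 /P.
  case: unliftP => [i|] ->.
    by rewrite pP// -[X in X = _]mulr_natr divfK// pnatr_eq0 -lt0n fact_gt0.
  by rewrite -derive1n_horner0 derive1n_vel_coord_poly// (leq_trans qr).
- by rewrite c0 -derive1n1 (derive1n_vel_coord_poly _ _ N0).
- exact: smooth_near_horner XP.
- near=> z; apply/rowP => i; rewrite !mxE c0 /P liftK tauE !horner_comp.
  by rewrite !hornerE addrAC subrr add0r.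
Unshelve. all: by end_near. Qed.

Hypothesis N0 : (0 < N)%N.

Let oT : open [set: 'rV[R]_n] := openT.
Let D := @vel_dom R n N [set: 'rV[R]_n].

Definition prolong (c : R -> 'rV[R]_n.+1) (z : R) : V :=
  \matrix_(q, a) (fun z => c z ord0 a)^`(q) z.

(** Along a prolonged curve d/dzeta is the ordinary derivative. The row [N] is
    where it would fail, and [jet_entry q] with [q < N] does not depend on it. *)
Lemma is_derive_prolong (c : R -> 'rV[R]_n.+1) z i q :
  (forall p a, derivable ((fun s => c s ord0 a)^`(p)) z 1) ->
  (q < N)%N -> D (prolong c z) ->
  is_derive z (1 : R) (fun y => jet_entry q i (prolong c y))
    (total_derivative (jet_entry q i) (prolong c z)).
Proof.
move=> dc qN Dz; have sJ := smooth_jet_entry (N := N) oT q i.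
have dp j : is_derive z (1 : R) (fcoord (vel_frame N) j \o prolong c)
    ((fun s => c s ord0 j.2)^`(j.1.+1) z).
  rewrite (_ : _ \o _ = (fun s => c s ord0 j.2)^`(j.1)); last first.
    by apply/funext => y; rewrite /= /mx_entry mxE.
  by split; [exact: dc|rewrite -derive1E].
have [dJ JE] := @is_derive_frame_comp _ _ _ (vel_frame N) (jet_entry q i) (prolong c) z 1
  (smooth_differentiable (vel_frame N) (vel_dom_open oT) sJ Dz)
  (fun j => @ex_derive _ _ _ _ _ _ _ (dp j)).
split => //; rewrite [LHS]JE (totE (vel_dom_open oT) sJ Dz).
apply: eq_bigr => -[p a] _; have [_ ->] := dp (p, a) => /=.
rewrite mxE; case: ltnP => pN.
  by rewrite /vel_coord mxE inordK.
rewrite (_ : 'D_(_) _ _ = 0) ?mulr0//.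
apply: derive_jet_entry_top (ltnW qN) _ => p' a' pq.
rewrite /vel_coord mxE -val_eqE /= inordK ?ltnS ?(leq_trans pq (ltnW qN))//.
by rewrite ltn_eqF// (leq_ltn_trans pq)// (leq_trans qN).
Qed.


(** Differentiating the identity of order [q] in the parameter gives, after
    division by the speed of t, the identity of order [q.+1]. The induction needs
    it on a neighbourhood of 0, not only at 0. *)
Lemma jet_along_curve (c : R -> 'rV[R]_n.+1) (X : R -> 'rV[R]_n) i q :
  smooth_near c 0 -> (time_part c)^`() 0 != 0 -> smooth_near X (time_part c 0) ->
  (\forall z \near (0 : R), X (time_part c z) = space_part c z) -> (q <= N)%N ->
  \forall z \near (0 : R),
    (fun s => X s ord0 i)^`(q) (time_part c z) = jet_entry q i (prolong c z).
Proof.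
move=> sc t0 sX Xc qN.
have dt z : (forall p a, derivable ((fun s => c s ord0 a)^`(p)) z 1) ->
    forall p, {for z, continuous ((time_part c)^`(p))}.
  move=> dc p; apply: differentiable_continuous; apply/derivable1_diffP; exact: dc.
have dc0 := nbhs_singleton sc.
have t'0 : \forall z \near (0 : R), (time_part c)^`() z != 0.
  rewrite -derive1n1 in t0 *.
  exact: (dt 0 dc0 1%N _ (open_nbhs_nbhs (conj (@open_neq R 0) t0))).
have sXc : \forall z \near (0 : R), forall p j,
    derivable ((fun s => X s ord0 j)^`(p)) (time_part c z) 1.
  exact: (dt 0 dc0 0%N _ sX).
elim: q qN => [|q IH] qN.
  near=> z; rewrite derive1n0 /= /vel_coord mxE inordK// derive1n0.
  have -> : X (time_part c z) = space_part c z by near: z.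
  by rewrite mxE.
have IH' := near_join (IH (ltnW qN)).
near=> z.
have dcz p a : derivable ((fun s => c s ord0 a)^`(p)) z 1.
  by have : forall p a, derivable ((fun s => c s ord0 a)^`(p)) z 1 by near: z.
have tz : (time_part c)^`() z != 0 by near: z.
have tdE : tdot (prolong c z) = (time_part c)^`() z.
  by rewrite tdotE /vel_coord mxE inordK// derive1n1.
have Dz : D (prolong c z) by split => //; rewrite tdE.
have [_ JE] := is_derive_prolong i dcz qN Dz.
rewrite derive1nS
  -[RHS]/(total_derivative (jet_entry q i) (prolong c z) / tdot (prolong c z)) tdE -JE.
have <- : 'D_1 ((fun s => X s ord0 i)^`(q) \o time_part c) z =
    'D_1 (fun y => jet_entry q i (prolong c y)) z.
  by apply: near_eq_derive; near: z.
have dtz : derivable (time_part c) z 1 := dcz 0%N ord0.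
have dXz : derivable ((fun s => X s ord0 i)^`(q)) (time_part c z) 1.
  by have : forall p j, derivable ((fun s => X s ord0 j)^`(p)) (time_part c z) 1 by near: z.
by rewrite -[X in _ = X / _]derive1E [X in _ = X / _]derive1_comp// mulfK.
Unshelve. all: by end_near. Qed.

Lemma represents_unique r xi j : (r <= N)%N ->
  represents (vel_trunc r xi) j -> j = to_jet r xi.
Proof.
move=> rN [c [X [[sc vc] t0 sX Xc ->]]].
have vE q a : (q <= r)%N -> vel_coord (prolong c 0) q a = vel_coord xi q a.
  move=> qr; rewrite -(vel_coord_trunc xi a qr) -vc /vel_coord !mxE !inordK//.
  by rewrite ltnS (leq_trans qr).
congr (_, _).
  by rewrite -vE// /vel_coord mxE inordK.
apply/matrixP => q i; rewrite !mxE.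
have qr : (q <= r)%N by rewrite -ltnS.
have qN : (q <= N)%N by exact: leq_trans qr rN.
rewrite (nbhs_singleton (jet_along_curve i sc t0 sX Xc qN)).
by apply: jet_entry_local => // p a pq; apply: vE; exact: leq_trans pq qr.
Qed.

Lemma wp_vel_trunc r xi : (r <= N)%N -> tdot xi != 0 ->
  wp (vel_trunc r xi) = to_jet r xi.
Proof.
move=> rN t0; have ex := represents_exists N0 rN t0.
by apply: represents_unique => //; exact: (xgetPex 0 ex).
Qed.

End Projection.

(** * Euler-Poisson expressions *)

Section EulerExpressions.
Context {R : realType} {n : nat} (U : set 'rV[R]_n).
Hypothesis oU : open U.

Lemma vel_trunc_id r (xi : velocities R r n) : vel_trunc r xi = xi.
Proof. by apply/matrixP => q a; rewrite mxE inord_val. Qed.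

Lemma smooth_pulled_back k (L : jets R k n -> R) : (0 < k)%N ->
  smooth_on (jet_dom U) L ->
  smooth_on (vel_dom U) (fun xi : velocities R k n => L (wp xi) * tdot xi).
Proof.
move=> k0 sL; have oV := @vel_dom_open R n k U oU.
apply: (smooth_ext oV (f := lifted_lagrangian L)) => [xi Dxi|].
  by rewrite -{2}(vel_trunc_id xi) (wp_vel_trunc k0)//; exact: tdot_neq0 Dxi.
apply: (smoothM (vel_frame k) oV); last exact: smooth_tdot.
exact: (smooth_to_jet oU).
Qed.

(** All the terms are moved to velocities of order 2k, where the adjoint calculus
    takes place. *)
Lemma euler_vel_adj k (L0 : velocities R k n -> R) a
    (xi : velocities R (2 * k) n) : (0 < k)%N ->
  smooth_on (vel_dom U) L0 -> vel_dom U xi ->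
  euler_vel L0 a xi =
  formal_adj k (fun m => 'D_(vel_basis m a) (L0 \o vel_trunc k)) (fun=> 1) xi.
Proof.
move=> k0 sL Dxi; apply: eq_bigr => m _; congr (_ * _).
have mk : (m <= k)%N by rewrite -ltnS.
have k2 : (k <= 2 * k)%N by rewrite mul2n -addnn leq_addr.
rewrite (iter_tot_d_dzeta oU k0 _ (smooth_derive _ sL) Dxi); last first.
  by rewrite mul2n -addnn leq_add2r.
congr (iter _ _ _ _); apply/funext => x; rewrite mulr1 derive_linear_precomp; last first.
  exact: vel_trunc_linear.
rewrite /=; congr ('D_ _ L0 _); apply/matrixP => q b.
rewrite !mxE -val_eqE /= -[X in _ = (X && _)%:R]val_eqE /= !inordK//.
- by rewrite ltnS (leq_trans mk).
- by rewrite ltnS (leq_trans _ k2)// -ltnS.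
Qed.

End EulerExpressions.

Theorem proposition1 (R : realType) (n k s : nat) (U : set 'rV[R]_n)
    (L : jets R k n -> R) (E : 'I_n -> jets R s n -> R) :
  (0 < k)%N ->
  (s <= 2 * k)%N ->
  open U ->
  smooth_on (jet_dom U) L ->
  (forall (i : 'I_n) (j : jets R (2 * k) n), jet_dom U j ->
     euler_jet L i j = E i (jet_trunc s j)) ->
  let L0 := fun xi : velocities R k n => L (wp xi) * tdot xi in
  forall xi : velocities R (2 * k) n, vel_dom U xi ->
    euler_vel L0 ord0 xi = - \sum_(i < n) xdot xi i * E i (wp (vel_trunc s xi)) /\
    (forall i : 'I_n,
       euler_vel L0 (lift ord0 i) xi = tdot xi * E i (wp (vel_trunc s xi))).
Proof.
move=> k0 sk oU sL hE L0 xi Dxi.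
have k2 : (k < 2 * k)%N by rewrite mul2n -addnn -addn1 leq_add2l.
have N0 : (0 < 2 * k)%N by exact: ltn_trans k2.
have L0E (x : velocities R (2 * k) n) : vel_dom U x ->
    L0 (vel_trunc k x) = lifted_lagrangian L x.
  move=> Dx; rewrite /L0 (wp_vel_trunc N0 (ltnW k2) (tdot_neq0 Dx)).
  by rewrite /tdot vel_coord_trunc.
have eulerE a : euler_vel L0 a xi =
    formal_adj k (fun m => 'D_(vel_basis m a) (lifted_lagrangian L)) (fun=> 1) xi.
  rewrite (euler_vel_adj oU)//; last exact: smooth_pulled_back.
  apply: (adj_ext (vel_dom_open oU)) => // m x _ Dx; congr (_ * _).
  apply: near_eq_derive.
  by apply: filterS (open_nbhs_nbhs (conj (vel_dom_open oU) Dx)) => y; exact: L0E.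
have EE i : E i (wp (vel_trunc s xi)) = spatial_euler L i xi.
  rewrite (spatial_eulerE oU k0 k2 sL)// hE; last exact: to_jet_dom.
  by rewrite jet_trunc_to_jet// (wp_vel_trunc N0 sk (tdot_neq0 Dxi)).
split=> [|i]; rewrite eulerE.
  rewrite (euler_lifted_time oU k0 k2 sL Dxi); congr (- _).
  by apply: eq_bigr => i _; rewrite EE.
by rewrite (euler_lifted_space oU k0 k2 sL i Dxi) EE.
Qed.
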